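(* Let $\alpha\in\mathbb{C}$, $\alpha\neq 0,-1$. For level $k=\alpha$, the bosonized forms $\phi_4(z),\phi_1^*(z),\psi_1(z),\psi_4^*(z)$ of the vertex operator components $\Phi_4(z),\Phi_1^*(z),\Psi_1(z),\Psi_4^*(z)$ (for $U_q[\widehat{sl(2|1)}]$ and the 4-dimensional evaluation module $V_{\alpha,z}$ and its dual $V^{*S}_{\alpha,z}$) are given by $$\phi_4(z)=\,:e^{-A^*(q^{\alpha+1}z;-\frac{\alpha}{2})}:,\qquad \phi_1^*(z)=\,:e^{B^*(q^{\alpha}z;-\frac{\alpha}{2})}:,$$ $$\psi_1(z)=\,:e^{-\tilde B^*(q^{\alpha}z;\frac{\alpha}{2})}:,\qquad \psi_4^*(z)=\,:e^{\tilde A^*(q^{\alpha-1}z;\frac{\alpha}{2})}:\,e^{\sqrt{-1}\pi(b^{13}_0+b^{23}_0)}.$$ The other components $\phi_r(z),\phi_r^*(z),\psi_r(z),\psi_r^*(z)$ are represented by multiple contour integrals of the Drinfeld currents, through the recursions listed in the context, in which $e_i=X^{+,i}_0=\oint\frac{dw}{2\pi\sqrt{-1}}X^{+,i}(w)$ and $f_i=X^{-,i}_0=\oint\frac{dw}{2\pi\sqrt{-1}}X^{-,i}(w)$, $i=1,2$.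
   Context: **Conventions.** $[x]_q=\frac{q^x-q^{-x}}{q-q^{-1}}$, $[X,Y]_\xi=XY-(-1)^{[X][Y]}\xi YX$, $[X,Y]=[X,Y]_1$, where $[X]\in\mathbb{Z}_2$ is the parity. $(a_{ij})_{i,j=1,2}=\begin{pmatrix}2&-1\\-1&0\end{pmatrix}$. **Oscillators (level $k\neq0,-1$).** $a^1_n,a^2_n,b^{12}_n,b^{13}_n,b^{23}_n,c_n$ ($n\in\mathbb{Z}$) and $Q_{a^1},Q_{a^2},Q_{b^{12}},Q_{b^{13}},Q_{b^{23}},Q_c$ with $[a^i_m,a^j_n]=\delta_{m+n,0}\frac{[a_{ij}m]_q[(k+1)m]_q}{m}$, $[a^i_0,Q_{a^j}]=(k+1)a_{ij}$; $[b^{ij}_m,b^{i'j'}_n]=(-1)^{\delta_{j2}}\delta_{ii'}\delta_{jj'}\delta_{m+n,0}\frac{[m]_q^2}{m}$, $[b^{ij}_0,Q_{b^{i'j'}}]=(-1)^{\delta_{j2}}\delta_{ii'}\delta_{jj'}$; $[c_m,c_n]=\delta_{m+n,0}\frac{[m]_q^2}{m}$, $[c_0,Q_c]=1$; all other commutators vanish. For a pair $(a_n,Q_a)$ put $$a(z;\kappa)=-\sum_{n\ne0}\frac{a_n}{[n]_q}q^{-\kappa|n|}z^{-n}+Q_a+a_0\ln z,\qquad a_\pm(z)=\pm(q-q^{-1})\sum_{n>0}a_{\pm n}z^{\mp n}\pm a_0\ln q .$$ Normal ordering $:\ :$ puts $a_n$ ($n<0$) and the $Q$'s to the left of $a_n$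 ($n\ge0$). These operators act on bosonic Fock modules generated by the negative modes over vectors $e^{\lambda_1Q_{a^1}+\lambda_2Q_{a^2}+\mu_{12}Q_{b^{12}}+\mu_{13}Q_{b^{13}}+\mu_{23}Q_{b^{23}}+\nu Q_c}|0\rangle$, where all modes with $n\ge0$ kill $|0\rangle$. **Bosonized generators of $U_q[\widehat{sl(2|1)}]$ at level $k$.** The Drinfeld generators are $X^{\pm,i}_n$, $h^i_n$ ($i=1,2$), with currents $X^{\pm,i}(z)=\sum_nX^{\pm,i}_nz^{-n-1}$; $X^{\pm,2}_n$ is odd, everything else even. They are realized by $h^1_0=a^1_0+2b^{12}_0+b^{13}_0-b^{23}_0$, $h^2_0=a^2_0-b^{12}_0-b^{13}_0$, and for $m\ne0$ $h^1_m=a^1_mq^{-\frac{|m|}2}+b^{12}_mq^{-(\frac k2+1)|m|}(q^{|m|}+q^{-|m|})+b^{13}_mq^{-(\frac k2+2)|m|}-b^{23}_mq^{-(\frac k2+1)|m|}$, $h^2_m=a^2_mq^{-\frac{|m|}2}-b^{12}_mq^{-(\frac k2+1)|m|}-b^{13}_mq^{-(\frac k2+1)|m|}$, $$X^{+,1}(z)=-\tfrac1{(q-q^{-1})z}:e^{-b^{12}(z;-1)}\big(e^{-c(qz;0)}-e^{-c(q^{-1}z;0)}\big):e^{\sqrt{-1}\pi(c_0+b^{12}_0)},$$ $$X^{+,2}(z)=-:e^{-b^{12}_+(qz)-b^{13}_+(qz)+b^{23}(qz;0)}:e^{\sqrt{-1}\pi(c_0+b^{12}_0+b^{13}_0+b^{23}_0)}+:e^{b^{12}(z;0)+b^{13}(z;0)+c(z;0)}:,$$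 $$X^{-,1}(z)=\tfrac1{(q-q^{-1})z}:\Big(e^{a^1_+(q^{\frac{k+1}2}z)+b^{12}(q^{k+2}z;1)+b^{13}_+(q^{k+2}z)-b^{23}_+(q^{k+1}z)+c(q^{k+1}z;0)}-e^{a^1_-(q^{-\frac{k+1}2}z)+b^{12}(q^{-k-2}z;1)+b^{13}_-(q^{-k-2}z)-b^{23}_-(q^{-k-1}z)+c(q^{-k-1}z;0)}\Big):e^{-\sqrt{-1}\pi(c_0+b^{12}_0)}$$ $$\qquad+q^{k+1}:e^{a^1_+(q^{\frac{k+1}2}z)-b^{13}(q^{k+1}z;0)+b^{23}(q^{k+1}z;-1)}:e^{\sqrt{-1}\pi(b^{13}_0+b^{23}_0)},$$ $$X^{-,2}(z)=\tfrac1{(q-q^{-1})z}\Big(q:\big(e^{a^2_+(q^{\frac{k+1}2}z)-b^{23}(q^{k+1}z;0)}-e^{a^2_-(q^{-\frac{k+1}2}z)-b^{23}(q^{-k-1}z;0)}\big):e^{-\sqrt{-1}\pi(c_0+b^{12}_0+b^{13}_0+b^{23}_0)}$$ $$\qquad-:e^{a^2_-(q^{-\frac{k+1}2}z)-b^{12}(q^{-k-1}z;1)-b^{13}(q^{-k-1}z;1)}\big(e^{-c(q^{-k}z;0)}-e^{-c(q^{-k-2}z;0)}\big):\Big).$$ **Combined oscillators** ($k=\alpha$, $m\in\mathbb{Z}$; at $m=0$ read $\frac{[2m]_q}{[m]_q}=2$, $\frac{[\alpha m]_q}{[(\alpha+1)m]_q}=\frac{\alpha}{\alpha+1}$): $A^*_m=-(a^1_m+\frac{[2m]_q}{[m]_q}a^2_m)q^{\frac{|m|}2}$,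 $B^*_m=-\frac{[\alpha m]_q}{[(\alpha+1)m]_q}(a^1_m+\frac{[2m]_q}{[m]_q}a^2_m)q^{\frac{|m|}2}$, $\tilde B^*_m=-(a^1_m+\frac{[2m]_q}{[m]_q}a^2_m)q^{-\frac{|m|}2}+(b^{13}_m+q^{-|m|}b^{23}_m)q^{-\frac\alpha2|m|}$, $\tilde A^*_m=-\frac{[\alpha m]_q}{[(\alpha+1)m]_q}(a^1_m+\frac{[2m]_q}{[m]_q}a^2_m)q^{-\frac{|m|}2}-(q^{|m|}b^{13}_m+b^{23}_m)q^{\frac{3\alpha}2|m|}$, $Q_{A^*}=-Q_{a^1}-2Q_{a^2}$, $Q_{B^*}=-\frac\alpha{\alpha+1}(Q_{a^1}+2Q_{a^2})$, $Q_{\tilde B^*}=-Q_{a^1}-2Q_{a^2}+Q_{b^{13}}+Q_{b^{23}}$, $Q_{\tilde A^*}=-\frac\alpha{\alpha+1}(Q_{a^1}+2Q_{a^2})-Q_{b^{13}}-Q_{b^{23}}$. **Evaluation modules.** $V_{\alpha,z}$ has basis $v_1,\dots,v_4$ ($v_1,v_4$ even, $v_2,v_3$ odd); with matrix units $e_{ij}$ the Chevalley generators act by $e_1=e_{23}$, $f_1=e_{32}$, $h_1=e_{22}-e_{33}$, $e_2=\sqrt{[\alpha]_q}e_{12}+\sqrt{[\alpha+1]_q}e_{34}$, $f_2=\sqrt{[\alpha]_q}e_{21}+\sqrt{[\alpha+1]_q}e_{43}$, $h_2=\alpha(e_{11}+e_{22})+(\alpha+1)(e_{33}+e_{44})$,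 $e_0=-z(-\sqrt{[\alpha]_q}e_{31}+\sqrt{[\alpha+1]_q}e_{42})$, $f_0=z^{-1}(-\sqrt{[\alpha]_q}e_{13}+\sqrt{[\alpha+1]_q}e_{24})$, $h_0=-\alpha(e_{11}+e_{33})-(\alpha+1)(e_{22}+e_{44})$. The dual $V^{*S}_{\alpha,z}$ (basis $v^*_r$) is given by $x\mapsto\pi_{V_{\alpha,z}}(S(x))^{st}$, with $S$ the antipode ($S(e_i)=-q^{-h_i}e_i$, $S(f_i)=-f_iq^{h_i}$, $S(h_i)=-h_i$) and $st$ the supertransposition. **Vertex operators.** For level-$k$ highest weight modules $V(\lambda),V(\mu)$, the type I operators $\Phi(z)=\sum_{r=1}^4\Phi_r(z)\otimes v_r:V(\lambda)\to V(\mu)\otimes V_{\alpha,z}$, $\Phi^*(z)=\sum_r\Phi^*_r(z)\otimes v^*_r:V(\lambda)\to V(\mu)\otimes V^{*S}_{\alpha,z}$ and the type II operators $\Psi(z)=\sum_rv_r\otimes\Psi_r(z):V(\lambda)\to V_{\alpha,z}\otimes V(\mu)$, $\Psi^*(z)=\sum_rv_r^*\otimes\Psi^*_r(z):V(\lambda)\to V^{*S}_{\alpha,z}\otimes V(\mu)$ are even operators $\Theta(z)$ with $\Theta(z)\,x=\Delta(x)\,\Theta(z)$ for all $x$, where $\Delta(e_i)=e_i\otimes1+q^{h_i}\otimes e_i$, $\Delta(f_i)=f_i\otimes q^{-h_i}+1\otimes f_i$, $\Delta(h_i)=h_i\otimes1+1\otimes h_i$. **Meaning of ''bosonized form''.**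 The bosonized components are free-field operators determined solely from commutation relations with the bosonized generators (independently of which infinite-dimensional modules are intertwined). The relations stated for the components are, for $i=1,2$, $n>0$ (with $k=\alpha$): - $[\Phi_4(z),X^{+,i}(w)]=0$, $q^{h^i_0}\Phi_4(z)q^{-h^i_0}=q^{-(\alpha+1)\delta_{i2}}\Phi_4(z)$, $[h^i_n,\Phi_4(z)]=-\delta_{i2}q^{(1+\frac32k)n}\frac{[(\alpha+1)n]_q}{n}z^n\Phi_4(z)$, $[h^i_{-n},\Phi_4(z)]=-\delta_{i2}q^{-(1+\frac12k)n}\frac{[(\alpha+1)n]_q}{n}z^{-n}\Phi_4(z)$; - $[\Phi_1^*(z),X^{+,i}(w)]=0$, $q^{h^i_0}\Phi_1^*(z)q^{-h^i_0}=q^{\alpha\delta_{i2}}\Phi_1^*(z)$, $[h^i_n,\Phi_1^*(z)]=\delta_{i2}q^{\frac32kn}\frac{[\alpha n]_q}{n}z^n\Phi_1^*(z)$, $[h^i_{-n},\Phi_1^*(z)]=\delta_{i2}q^{-\frac12kn}\frac{[\alpha n]_q}{n}z^{-n}\Phi_1^*(z)$; - $[\Psi_1(z),X^{-,i}(w)]=0$, $q^{h^i_0}\Psi_1(z)q^{-h^i_0}=q^{-\alpha\delta_{i2}}\Psi_1(z)$, $[h^i_n,\Psi_1(z)]=-\delta_{i2}q^{\frac12kn}\frac{[\alpha n]_q}{n}z^n\Psi_1(z)$, $[h^i_{-n},\Psi_1(z)]=-\delta_{i2}q^{-\frac32kn}\frac{[\alpha n]_q}{n}z^{-n}\Psi_1(z)$;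 - $[\Psi_4^*(z),X^{-,i}(w)]=0$, $q^{h^i_0}\Psi_4^*(z)q^{-h^i_0}=q^{(\alpha+1)\delta_{i2}}\Psi_4^*(z)$, $[h^i_n,\Psi_4^*(z)]=\delta_{i2}q^{(\frac12k-1)n}\frac{[(\alpha+1)n]_q}{n}z^n\Psi_4^*(z)$, $[h^i_{-n},\Psi_4^*(z)]=\delta_{i2}q^{(-\frac32k+1)n}\frac{[(\alpha+1)n]_q}{n}z^{-n}\Psi_4^*(z)$. **Recursions** (components $r=1,4$ even, $r=2,3$ odd): $\phi_3=-\frac1{\sqrt{[\alpha+1]_q}}[\phi_4,f_2]_{q^{-\alpha-1}}$, $\phi_2=[\phi_3,f_1]_q$, $\phi_1=-\frac1{\sqrt{[\alpha]_q}}[\phi_2,f_2]_{q^{-\alpha}}$; $\psi_2=\frac1{\sqrt{[\alpha]_q}}[\psi_1,e_2]_{q^\alpha}$, $\psi_3=[\psi_2,e_1]_q$, $\psi_4=\frac1{\sqrt{[\alpha+1]_q}}[\psi_3,e_2]_{q^{\alpha+1}}$; $\phi^*_2=\frac{q^{-\alpha}}{\sqrt{[\alpha]_q}}[\phi^*_1,f_2]_{q^\alpha}$, $\phi_3^*=-q^{-1}[\phi^*_2,f_1]_q$, $\phi^*_4=-\frac{q^{-\alpha-1}}{\sqrt{[\alpha+1]_q}}[\phi^*_3,f_2]_{q^{\alpha+1}}$; $\psi^*_3=-\frac{q^{\alpha+1}}{\sqrt{[\alpha+1]_q}}[\psi^*_4,e_2]_{q^{-\alpha-1}}$, $\psi^*_2=-q[\psi^*_3,e_1]_q$,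 $\psi_1^*=\frac{q^\alpha}{\sqrt{[\alpha]_q}}[\psi^*_2,e_2]_{q^{-\alpha}}$.
   Formalization: The formula for ψ_1(z) is corrected by the extra right factor e^{√-1π(b^{13}_0+b^{23}_0)}: without it the displayed exponential anticommutes with X^{-,2}(w), contradicting [Ψ_1(z),X^{-,2}(w)]=0. *)

(* Defs.v *)
From HB Require Import structures.
From mathcomp Require Import all_boot all_order all_algebra.
From mathcomp Require Import all_classical all_reals all_analysis.
From mathcomp Require Import complex.

Set Implicit Arguments.
Unset Strict Implicit.
Unset Printing Implicit Defensive.

Import Order.TTheory GRing.Theory Num.Theory.

Local Open Scope classical_set_scope.
Local Open Scope ring_scope.

Section QNumbers.
Variable R : realType.
Local Notation C := R[i].

Definition cexp (u : C) : C :=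
  Complex (expR (complex.Re u) * cos (complex.Im u))
          (expR (complex.Re u) * sin (complex.Im u)).

Definition ipi : C := Complex 0 pi.

(* The deformation parameter is given through its logarithm: q = e^lnq, so that
   q^u is unambiguous for complex u. *)
Variable lnq : C.

Definition qpow (u : C) : C := cexp (lnq * u).

Definition qnum (u : C) : C := (qpow u - qpow (- u)) / (qpow 1 - qpow (- 1)).

End QNumbers.

Inductive node := N1 | N2.

Definition cartan (i j : node) : int :=
  match i, j with
  | N1, N1 => 2
  | N2, N2 => 0
  | _, _ => - 1
  end.

Definition is2 (i : node) : bool := if i is N2 then true else false.

Inductive boson := a_ of node | b12 | b13 | b23 | c_.

Definition boson_eq_dec : comparable boson.
Proof. by rewrite /comparable /decidable; decide equality; decide equality. Defined.

HB.instance Definition _ := hasDecEq.Build boson (compareP boson_eq_dec).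

Definition bosons : seq boson := [:: a_ N1; a_ N2; b12; b13; b23; c_].

(* The letters occurring in the exponent of a vertex operator: [Mode s n] is
   x^s_n z^(-n) with n != 0, [Charge s] is Q_s, [LogZ s] is x^s_0 ln z and
   [Zero s] is x^s_0, for the oscillator x^s of species s. *)
Inductive letter :=
  Mode of boson & int | Charge of boson | LogZ of boson | Zero of boson.

Section Bosonization.
Variable R : realType.
Local Notation C := R[i].
Variables (lnq : C) (k : C).
Local Notation q_ := (qpow lnq).
Local Notation qn := (qnum lnq).

(* [x^s_m, x^t_(-m)] = gram s t m for m != 0, and [x^s_0, Q_t] = gram0 s t. *)
Definition gram (s t : boson) (m : int) : C :=
  match s, t with
  | a_ i, a_ j =>
      qn ((cartan i j)%:~R * m%:~R) * qn ((k + 1) * m%:~R) / m%:~R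
  | b12, b12 => - (qn m%:~R ^+ 2 / m%:~R)
  | b13, b13 | b23, b23 | c_, c_ => qn m%:~R ^+ 2 / m%:~R
  | _, _ => 0
  end.

Definition gram0 (s t : boson) : C :=
  match s, t with
  | a_ i, a_ j => (k + 1) * (cartan i j)%:~R
  | b12, b12 => - 1
  | b13, b13 | b23, b23 | c_, c_ => 1
  | _, _ => 0
  end.

(* The coefficients (l1, l2, m12, m13, m23, n) of the Fock vacuum
   e^(l1 Q_a1 + l2 Q_a2 + m12 Q_b12 + m13 Q_b13 + m23 Q_b23 + n Q_c) |0>. *)
Definition charge := boson -> C.

Definition zero_mode (s : boson) (lam : charge) : C :=
  \sum_(t <- bosons) gram0 s t * lam t.

(* F with the operators x s n (n != 0) is the Fock module of the nonzero modes;
   the entries x s 0 play no role, as zero modes are treated in [fock]. *)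
Record fock_module (F : lmodType C) (x : boson -> int -> {linear F -> F})
    (vac : F) : Prop := {
  fock_comm : forall (s t : boson) (m n : int) (v : F), m != 0 -> n != 0 ->
    x s m (x t n v) - x t n (x s m v)
      = (if m + n == 0 then gram s t m else 0) *: v;
  fock_vac : forall (s : boson) (n : int), 0 < n -> x s n vac = 0;
  fock_gen : forall P : F -> Prop,
    P vac ->
    (forall (c : C) (u v : F), P u -> P v -> P (c *: u + v)) ->
    (forall (s : boson) (n : int) (v : F), n < 0 -> P v -> P (x s n v)) ->
    forall v, P v
}.

Definition expo := letter -> C.

Record osc := Osc { omode : int -> boson -> C; ocharge : boson -> C }.

Definition basic (s : boson) : osc :=
  Osc (fun _ t => (t == s)%:R) (fun t => (t == s)%:R).

(* cur o kappa = o(z; kappa), curp o = o_+(z), curm o = o_-(z). *)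
Definition cur (o : osc) (kappa : C) : expo := fun y =>
  match y with
  | Mode s n =>
      if n == 0 then 0
      else - (omode o n s / qn n%:~R * q_ (- kappa * `|n|%N%:R))
  | Charge s => ocharge o s
  | LogZ s => omode o 0 s
  | Zero s => 0
  end.

Definition curp (o : osc) : expo := fun y =>
  match y with
  | Mode s n => if 0 < n then (q_ 1 - q_ (- 1)) * omode o n s else 0
  | Zero s => lnq * omode o 0 s
  | _ => 0
  end.

Definition curm (o : osc) : expo := fun y =>
  match y with
  | Mode s n => if n < 0 then - ((q_ 1 - q_ (- 1)) * omode o n s) else 0
  | Zero s => - (lnq * omode o 0 s)
  | _ => 0
  end.

(* J(q^u z), with ln (q^u z) = u ln q + ln z. *)
Definition qscale (u : C) (J : expo) : expo := fun y =>
  match y with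
  | Mode s n => J (Mode s n) * q_ (- u * n%:~R)
  | Zero s => J (Zero s) + lnq * u * J (LogZ s)
  | _ => J y
  end.

Section Operators.
Variables (F : lmodType C) (x : boson -> int -> {linear F -> F}).

(* All the Fock modules at once: a vector is given by its component in the
   module over each vacuum e^lam |0>, a copy of F on which x^s_0 acts as the
   scalar [zero_mode s lam]. *)
Definition fock := charge -> F.

(* A formal series sum_s A_s z^s, s in C, with operator coefficients; exponents
   are complex because of z^(x_0). *)
Definition field := C -> fock -> fock.

(* exp_coef u d is the coefficient of t^d in exp (sum_(n > 0) u n t^n), and
   pow_coef u m d the one in (sum_(n > 0) u n t^n)^m. *)
Fixpoint pow_coef (u : nat -> F -> F) (m d : nat) (v : F) : F :=
  if m is m'.+1 then \sum_(1 <= j < d.+1) u j (pow_coef u m' (d - j)%N v)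
  else if d == 0%N then v else 0.

Definition exp_coef (u : nat -> F -> F) (d : nat) (v : F) : F :=
  \sum_(0 <= m < d.+1) (m`!%:R : C)^-1 *: pow_coef u m d v.

Definition creation (J : expo) (n : nat) (v : F) : F :=
  \sum_(s <- bosons) J (Mode s (- n%:Z)) *: x s (- n%:Z) v.

Definition annihilation (J : expo) (n : nat) (v : F) : F :=
  \sum_(s <- bosons) J (Mode s n%:Z) *: x s n%:Z v.

(* The normally ordered exponential :e^J:. The sum over pairs (d, e) is a sum
   with finite support, since [exp_coef (annihilation J) e] kills a given vector
   of F for e large. *)
Definition nexp (J : expo) : field := fun s f mu =>
  let lam : charge := mu - (fun t => J (Charge t)) in
  cexp (\sum_(t <- bosons) J (Zero t) * zero_mode t lam) *:
  \sum_(p \in [set p : nat * nat |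
        \sum_(t <- bosons) J (LogZ t) * zero_mode t lam + p.1%:R - p.2%:R = s])
    exp_coef (creation J) p.1 (exp_coef (annihilation J) p.2 (f lam)).

(* e^(i pi eps (sum of the zero modes of the species in l)) *)
Definition phase (eps : C) (l : seq boson) (f : fock) : fock := fun lam =>
  cexp (ipi R * eps * \sum_(t <- l) zero_mode t lam) *: f lam.

Definition fcomp (A : field) (B : fock -> fock) : field := fun s f => A s (B f).

(* z^u A(z) *)
Definition zmul (u : C) (A : field) : field := fun s => A (s - u).

(* [X, Y]_xi = X Y - (-1)^([X][Y]) xi Y X for X, Y of parities pX, pY. *)
Definition bracket (pX pY : bool) (xi : C) (X Y : fock -> fock) : fock -> fock :=
  fun f => X (Y f) - ((-1) ^+ (pX && pY) * xi) *: Y (X f).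

(* X_n in X(z) = sum_n X_n z^(-n-1). On the Fock modules with m13, m23 and
   n - m12 integers, the exponents of z in the currents below are integers, so
   that they are the sums of their modes. *)
Definition mode (A : field) (n : int) : fock -> fock := A (- n%:~R - 1).

(* Contour integration of a formal series in w, with the measure
   dw / (2 pi i): the coefficient of w^(-1). *)
Definition oint (A : field) : fock -> fock := A (- 1).

Local Notation a1 := (a_ N1).
Local Notation a2 := (a_ N2).
Local Notation "'cu' s" := (cur (basic s)) (at level 9).
Local Notation cp s := (curp (basic s)).
Local Notation cm s := (curm (basic s)).

Definition h_coef (i : node) (m : int) (s : boson) : C :=
  let am : C := `|m|%N%:R in
  match i, s with
  | N1, a_ N1 => q_ (- am / 2)
  | N1, b12 => q_ (- (k / 2 + 1) * am) * (q_ am + q_ (- am))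
  | N1, b13 => q_ (- (k / 2 + 2) * am)
  | N1, b23 => - q_ (- (k / 2 + 1) * am)
  | N2, a_ N2 => q_ (- am / 2)
  | N2, b12 | N2, b13 => - q_ (- (k / 2 + 1) * am)
  | _, _ => 0
  end.

Definition h_mode (i : node) (m : int) : fock -> fock := fun f lam =>
  if m == 0 then (\sum_(s <- bosons) h_coef i 0 s * zero_mode s lam) *: f lam
  else \sum_(s <- bosons) h_coef i m s *: x s m (f lam).

(* q^(u h^i_0) *)
Definition qh0 (i : node) (u : C) : fock -> fock := fun f lam =>
  q_ (u * \sum_(s <- bosons) h_coef i 0 s * zero_mode s lam) *: f lam.

Definition Xplus (i : node) : field :=
  match i with
  | N1 =>
      - (q_ 1 - q_ (- 1))^-1 *: zmul (- 1)
        (fcomp (nexp (- cu b12 (- 1) - qscale 1 (cu c_ 0))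
                - nexp (- cu b12 (- 1) - qscale (- 1) (cu c_ 0)))
               (phase 1 [:: c_; b12]))
  | N2 =>
      - fcomp (nexp (- qscale 1 (cp b12) - qscale 1 (cp b13)
                     + qscale 1 (cu b23 0)))
              (phase 1 [:: c_; b12; b13; b23])
      + nexp (cu b12 0 + cu b13 0 + cu c_ 0)
  end.

Definition Xminus (i : node) : field :=
  match i with
  | N1 =>
      (q_ 1 - q_ (- 1))^-1 *: zmul (- 1)
        (fcomp
          (nexp (qscale ((k + 1) / 2) (cp a1) + qscale (k + 2) (cu b12 1)
                 + qscale (k + 2) (cp b13) - qscale (k + 1) (cp b23)
                 + qscale (k + 1) (cu c_ 0))
           - nexp (qscale (- (k + 1) / 2) (cm a1)
                   + qscale (- k - 2) (cu b12 1)
                   + qscale (- k - 2) (cm b13) - qscale (- k - 1) (cm b23)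
                   + qscale (- k - 1) (cu c_ 0)))
          (phase (- 1) [:: c_; b12]))
      + q_ (k + 1) *:
        fcomp (nexp (qscale ((k + 1) / 2) (cp a1) - qscale (k + 1) (cu b13 0)
                     + qscale (k + 1) (cu b23 (- 1))))
              (phase 1 [:: b13; b23])
  | N2 =>
      (q_ 1 - q_ (- 1))^-1 *: zmul (- 1)
        (q_ 1 *:
          fcomp (nexp (qscale ((k + 1) / 2) (cp a2)
                       - qscale (k + 1) (cu b23 0))
                 - nexp (qscale (- (k + 1) / 2) (cm a2)
                         - qscale (- k - 1) (cu b23 0)))
                (phase (- 1) [:: c_; b12; b13; b23])
         - (nexp (qscale (- (k + 1) / 2) (cm a2)
                  - qscale (- k - 1) (cu b12 1) - qscale (- k - 1) (cu b13 1)
                  - qscale (- k) (cu c_ 0))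
            - nexp (qscale (- (k + 1) / 2) (cm a2)
                    - qscale (- k - 1) (cu b12 1) - qscale (- k - 1) (cu b13 1)
                    - qscale (- k - 2) (cu c_ 0))))
  end.

Definition e_gen (i : node) : fock -> fock := mode (Xplus i) 0.
Definition f_gen (i : node) : fock -> fock := mode (Xminus i) 0.

End Operators.
End Bosonization.

Section VertexOperators.
Variable R : realType.
Local Notation C := R[i].
Variables (lnq : C) (alpha : C).
Local Notation q_ := (qpow lnq).
Local Notation qn := (qnum lnq).

Definition ratio2 (m : int) : C :=
  if m == 0 then 2 else qn (2 * m%:~R) / qn m%:~R.

Definition ratioA (m : int) : C :=
  if m == 0 then alpha / (alpha + 1)
  else qn (alpha * m%:~R) / qn ((alpha + 1) * m%:~R).

(* a^1_m + [2m]/[m] a^2_m and Q_a1 + 2 Q_a2. *)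
Definition D_mode (m : int) (s : boson) : C :=
  match s with a_ N1 => 1 | a_ N2 => ratio2 m | _ => 0 end.

Definition D_charge (s : boson) : C :=
  match s with a_ N1 => 1 | a_ N2 => 2 | _ => 0 end.

Definition Astar : osc R :=
  Osc (fun m s => - (D_mode m s * q_ (`|m|%N%:R / 2)))
      (fun s => - D_charge s).

Definition Bstar : osc R :=
  Osc (fun m s => - (ratioA m * D_mode m s * q_ (`|m|%N%:R / 2)))
      (fun s => - (alpha / (alpha + 1) * D_charge s)).

Definition Btilde : osc R :=
  Osc (fun m s =>
         - (D_mode m s * q_ (- `|m|%N%:R / 2))
         + ((s == b13)%:R + q_ (- `|m|%N%:R) * (s == b23)%:R)
           * q_ (- alpha / 2 * `|m|%N%:R))
      (fun s => - D_charge s + (s == b13)%:R + (s == b23)%:R).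

Definition Atilde : osc R :=
  Osc (fun m s =>
         - (ratioA m * D_mode m s * q_ (- `|m|%N%:R / 2))
         - (q_ `|m|%N%:R * (s == b13)%:R + (s == b23)%:R)
           * q_ (3 * alpha / 2 * `|m|%N%:R))
      (fun s => - (alpha / (alpha + 1) * D_charge s)
                - (s == b13)%:R - (s == b23)%:R).

Variables (F : lmodType C) (x : boson -> int -> {linear F -> F}).
Local Notation field := (field F).
Local Notation Xp := (Xplus lnq alpha x).
Local Notation Xm := (Xminus lnq alpha x).
Local Notation vexp := (nexp alpha x).

Definition phi4 : field :=
  vexp (- qscale lnq (alpha + 1) (cur lnq Astar (- alpha / 2))).

Definition phis1 : field :=
  vexp (qscale lnq alpha (cur lnq Bstar (- alpha / 2))).

(* The factor e^(i pi (b13_0 + b23_0)) is needed: without it the exponential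
   anticommutes with X^{-,2}(w), because its charge -Q_b13 - Q_b23 (a single
   factor e^(-Q_b23), resp. e^(-Q_b13), against each term of X^{-,2}) produces
   w - q^alpha z in one order and q^alpha z - w in the other. *)
Definition psi1 : field :=
  fcomp (vexp (- qscale lnq alpha (cur lnq Btilde (alpha / 2))))
        (phase alpha 1 [:: b13; b23]).

Definition psis4 : field :=
  fcomp (vexp (qscale lnq (alpha - 1) (cur lnq Atilde (alpha / 2))))
        (phase alpha 1 [:: b13; b23]).

Local Notation sqA := (sqrtC (qn alpha)).
Local Notation sqB := (sqrtC (qn (alpha + 1))).

(* The booleans are the parities of the two entries of the bracket. *)
Definition phi3 : field := fun s =>
  - sqB^-1 *: oint (fun w1 =>
    bracket false true (q_ (- alpha - 1)) (phi4 s) (Xm N2 w1)).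

Definition phi2 : field := fun s =>
  - sqB^-1 *: oint (fun w1 => oint (fun w2 =>
    bracket true false (q_ 1)
      (bracket false true (q_ (- alpha - 1)) (phi4 s) (Xm N2 w1))
      (Xm N1 w2))).

Definition phi1 : field := fun s =>
  (sqA * sqB)^-1 *: oint (fun w1 => oint (fun w2 => oint (fun w3 =>
    bracket true true (q_ (- alpha))
      (bracket true false (q_ 1)
        (bracket false true (q_ (- alpha - 1)) (phi4 s) (Xm N2 w1))
        (Xm N1 w2))
      (Xm N2 w3)))).

Definition psi2 : field := fun s =>
  sqA^-1 *: oint (fun w1 =>
    bracket false true (q_ alpha) (psi1 s) (Xp N2 w1)).

Definition psi3 : field := fun s =>
  sqA^-1 *: oint (fun w1 => oint (fun w2 =>
    bracket true false (q_ 1)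
      (bracket false true (q_ alpha) (psi1 s) (Xp N2 w1))
      (Xp N1 w2))).

Definition psi4 : field := fun s =>
  (sqA * sqB)^-1 *: oint (fun w1 => oint (fun w2 => oint (fun w3 =>
    bracket true true (q_ (alpha + 1))
      (bracket true false (q_ 1)
        (bracket false true (q_ alpha) (psi1 s) (Xp N2 w1))
        (Xp N1 w2))
      (Xp N2 w3)))).

Definition phis2 : field := fun s =>
  (q_ (- alpha) / sqA) *: oint (fun w1 =>
    bracket false true (q_ alpha) (phis1 s) (Xm N2 w1)).

Definition phis3 : field := fun s =>
  - (q_ (- alpha - 1) / sqA) *: oint (fun w1 => oint (fun w2 =>
    bracket true false (q_ 1)
      (bracket false true (q_ alpha) (phis1 s) (Xm N2 w1))
      (Xm N1 w2))).

Definition phis4 : field := fun s =>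
  (q_ (- 2 * alpha - 2) / (sqA * sqB)) *:
  oint (fun w1 => oint (fun w2 => oint (fun w3 =>
    bracket true true (q_ (alpha + 1))
      (bracket true false (q_ 1)
        (bracket false true (q_ alpha) (phis1 s) (Xm N2 w1))
        (Xm N1 w2))
      (Xm N2 w3)))).

Definition psis3 : field := fun s =>
  - (q_ (alpha + 1) / sqB) *: oint (fun w1 =>
    bracket false true (q_ (- alpha - 1)) (psis4 s) (Xp N2 w1)).

Definition psis2 : field := fun s =>
  (q_ (alpha + 2) / sqB) *: oint (fun w1 => oint (fun w2 =>
    bracket true false (q_ 1)
      (bracket false true (q_ (- alpha - 1)) (psis4 s) (Xp N2 w1))
      (Xp N1 w2))).

Definition psis1 : field := fun s =>
  (q_ (2 * alpha + 2) / (sqA * sqB)) *: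
  oint (fun w1 => oint (fun w2 => oint (fun w3 =>
    bracket true true (q_ (- alpha))
      (bracket true false (q_ 1)
        (bracket false true (q_ (- alpha - 1)) (psis4 s) (Xp N2 w1))
        (Xp N1 w2))
      (Xp N2 w3)))).

End VertexOperators.

(* Main.v *)
Require Import Defs.
From mathcomp Require Import all_boot all_order all_algebra.
From mathcomp Require Import all_classical all_reals all_analysis.
From mathcomp Require Import complex ring zify.
From Stdlib Require QArith.

(* Wick's theorem: moving the annihilation part of [:e^J(z):] past the creation
   part of [:e^K(w):] costs the factor exp (sum_n c_n (w/z)^n), c_n being the
   commutator of the n-th modes, times a power of z from the zero modes.  For
   each vertex operator and each single term of the currents it must commute
   with, c_n is either 0 or - g^n / n.  In the first case the two exponentials
   commute up to a phase; in the second the two orders give z - g w and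
   w - g^-1 z up to scalars, and the phases e^(i pi b_0) turn the resulting sign
   into a plus.  So the vertex operators commute with every term of the currents
   separately, and no delta function ever appears.  The relations with h^i_n are
   one-mode commutators, and the recursions only use linearity of the currents. *)

Set Implicit Arguments.
Unset Strict Implicit.
Unset Printing Implicit Defensive.

Import Order.TTheory GRing.Theory Num.Theory.
Local Open Scope ring_scope.

(** * Exponentials of families of operators *)

Section ExpCoef.
Variables (R : realType) (F : lmodType R[i]).
Local Notation C := R[i].

(** The fields are formal, with complex exponents, so Wick's theorem has to be an identity between
    coefficients. It can be one because exp (- sum_n (g t)^n / n) = 1 - g t is a polynomial: a
    product of two exponentials has just two normally ordered terms. The identity is obtained from t
    d/dt exp u = (t u') exp u, which turns it into an induction on the degree. The sum over
    intermediate annihilation degrees is finite on each vector; [fock_module] gives no grading, so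
    this finiteness is derived from the commutation relations and from generation by the vacuum. The
    contractions are so simple because a^1_n + [2n]/[n] a^2_n is orthogonal to a^1_n for the Gram
    form: of a current, only the a^2, b^13 and b^23 parts meet the vertex operators. The hypotheses
    on [n] and [(alpha+1) n] are exactly what makes the denominators in the exponents invertible. *)

Lemma lin0 (g : F -> F) : linear g -> g 0 = 0.
Proof. by move=> gL; rewrite -[X in g X](subrr (0 : F)) -scaleN1r addrC gL scaleN1r addNr. Qed.

Lemma linD (g : F -> F) : linear g -> {morph g : v w / v + w}.
Proof. by move=> gL v w; rewrite -[v in LHS]scale1r gL scale1r. Qed.

Lemma linZ (g : F -> F) : linear g -> forall c, {morph g : v / c *: v}.
Proof. by move=> gL c v; rewrite -[in LHS](addr0 (c *: v)) gL lin0 // addr0. Qed.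

Lemma linB (g : F -> F) : linear g -> {morph g : v w / v - w}.
Proof. by move=> gL v w; rewrite linD // -scaleN1r linZ // scaleN1r. Qed.

Lemma lin_sum (g : F -> F) : linear g ->
  forall (I : Type) (r : seq I) (P : pred I) (w : I -> F),
  g (\sum_(i <- r | P i) w i) = \sum_(i <- r | P i) g (w i).
Proof. by move=> gL I r P w; apply: big_morph; [exact: linD|exact: lin0]. Qed.

Lemma triangular_sum_swap (d : nat) (G : nat -> nat -> F) :
  \sum_(1 <= i < d.+1) \sum_(1 <= j < (d - i).+1) G i j =
  \sum_(1 <= j < d.+1) \sum_(1 <= i < (d - j).+1) G i j.
Proof.
rewrite (@eq_big_nat _ _ _ _ _ _ (fun i =>
  \sum_(1 <= j < d.+1 | (i + j < d.+1)%N) G i j)); last first.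
  move=> i /andP[i_gt0 lti]; rewrite (big_nat_widen _ _ d.+1); last by lia.
  by apply: eq_bigl => j; lia.
rewrite (exchange_big_dep_nat xpredT) //=; apply: eq_big_nat => j /andP[j_gt0 ltj].
rewrite [RHS](big_nat_widen _ _ d.+1); last by lia.
by apply: eq_bigl => i; lia.
Qed.

Section Family.
Variable u : nat -> F -> F.
Hypothesis u_lin : forall j, linear (u j).

Lemma pow_coef_linear m d : linear (pow_coef u m d).
Proof.
elim: m d => [|m IHm] d c v w /=.
  by case: ifP => // _; rewrite scaler0 addr0.
rewrite scaler_sumr -big_split; apply: eq_bigr => j _ /=.
by rewrite IHm u_lin.
Qed.

Lemma exp_coef_linear d : linear (exp_coef u d).
Proof.
move=> c v w; rewrite /exp_coef scaler_sumr -big_split; apply: eq_bigr => m _ /=.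
by rewrite pow_coef_linear scalerDr !scalerA mulrC.
Qed.

(** Every factor has degree at least 1, so the m-th power starts in degree m. Hence the sum defining
    [exp_coef] may be extended to any larger common range. *)
Lemma pow_coef_eq0 m d v : (d < m)%N -> pow_coef u m d v = 0.
Proof.
elim: m d => [|m IHm] d //= ltdm; rewrite big_nat_cond big1 // => j /andP[/andP[j0 ltj] _].
by rewrite IHm ?(lin0 (u_lin j)) //; lia.
Qed.

Lemma exp_coef_widen N d v : (d < N)%N ->
  exp_coef u d v = \sum_(0 <= m < N) (m`!%:R : C)^-1 *: pow_coef u m d v.
Proof.
move=> ltdN; rewrite /exp_coef [RHS](@big_cat_nat _ _ _ d.+1) //= [X in _ = _ + X]big_nat_cond.
rewrite [X in _ = _ + X]big1 ?addr0 // => m /andP[/andP[lt_dm _] _].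
by rewrite pow_coef_eq0 ?scaler0.
Qed.

Lemma exp_coef0 v : exp_coef u 0 v = v.
Proof. by rewrite /exp_coef big_nat1 /= invr1 scale1r. Qed.

Section Commutator.
Variables (U : F -> F) (j : nat) (kap : C).
Hypotheses (U_lin : linear U) (j_gt0 : (0 < j)%N).
Hypothesis U_u : forall i v, (0 < i)%N ->
  U (u i v) = u i (U v) + (if i == j then kap else 0) *: v.

(** Leibniz rule: [U, u(t)] = kap t^j is a scalar, so [U, u(t)^m] = m kap t^j u(t)^(m-1). At m = 0
    the value of [m.-1] is harmless because of the factor m. *)
Lemma pow_coef_comm m d v : U (pow_coef u m d v) =
  pow_coef u m d (U v)
  + (m%:R * kap) *: (if (j <= d)%N then pow_coef u m.-1 (d - j) v else 0).
Proof.
elim: m d => [|m IHm] d.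
  rewrite mul0r scale0r addr0 /=.
  by case: ifP => // _; rewrite (lin0 U_lin).
rewrite /= (lin_sum U_lin) /=.
under eq_big_nat => i /andP[i0 _].
  rewrite U_u // IHm (linD (u_lin i)) (linZ (u_lin i)) /=.
  over.
rewrite 2!big_split /= -scaler_sumr -addrA; congr (_ + _).
have -> : \sum_(1 <= i < d.+1) (if i == j then kap else 0) *: pow_coef u m (d - i) v =
    kap *: (if (j <= d)%N then pow_coef u m (d - j) v else 0).
  case: leqP => [lejd|ltdj]; last first.
    rewrite scaler0 big_nat_cond big1 // => i /andP[/andP[_ ltid] _].
    by rewrite ifF ?scale0r //; lia.
  rewrite (bigD1_seq j) ?iota_uniq //=; last by rewrite mem_index_iota; lia.
  rewrite eqxx big1 ?addr0 // => i /negbTE->; exact: scale0r.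
rewrite -natr1 mulrDl mul1r scalerDl; congr (_ + _).
case: m {IHm} => [|m]; first by rewrite !mul0r !scale0r.
congr (_ *: _); case: leqP => [lejd|ltdj]; last first.
  rewrite big_nat_cond big1 // => i /andP[/andP[_ ltid] _].
  by rewrite ifF ?(lin0 (u_lin i)) //; lia.
rewrite /= [RHS](big_nat_widen _ _ d.+1); last by lia.
rewrite [RHS]big_mkcond /=; apply: eq_big_nat => i /andP[i0 ltid].
have -> : (d - j - i = d - i - j)%N by lia.
by case: ifP => [h|h]; [rewrite ifT //; lia|rewrite ifF ?(lin0 (u_lin i)) //; lia].
Qed.

(** Since m / m! = 1 / (m-1)!, summing the Leibniz rule gives [U, exp u(t)] = kap t^j exp u(t). *)
Lemma exp_coef_comm d v : U (exp_coef u d v) =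
  exp_coef u d (U v) + kap *: (if (j <= d)%N then exp_coef u (d - j) v else 0).
Proof.
rewrite {1 2}/exp_coef (lin_sum U_lin) /=.
under eq_bigr => m _.
  rewrite (linZ U_lin) /= pow_coef_comm scalerDr scalerA; over.
rewrite big_split /=; congr (_ + _).
case: leqP => [lejd|_]; last first.
  by rewrite scaler0 big1 // => m _; rewrite scaler0.
rewrite (@exp_coef_widen d) ?ltn_subrL ?j_gt0 ?(leq_trans j_gt0) //.
rewrite big_nat_recl // mul0r mulr0 scale0r add0r scaler_sumr.
apply: eq_bigr => m _ /=; rewrite scalerA factS natrM; congr (_ *: _).
have m1 : m.+1%:R != 0 :> C by rewrite pnatr_eq0.
have mf : m`!%:R != 0 :> C by rewrite pnatr_eq0 -lt0n fact_gt0.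
by move: m1 mf; move: m.+1%:R m`!%:R => a b a0 b0; field; rewrite ?a0 ?b0.
Qed.

End Commutator.

Hypothesis u_comm : forall i j v, (0 < i)%N -> (0 < j)%N ->
  u i (u j v) = u j (u i v).

(* [t d/dt (u(t)^m) = m (t u'(t)) u(t)^(m-1)], coefficientwise. *)
Lemma pow_coef_rec m d v : d%:R *: pow_coef u m d v =
  m%:R *: \sum_(1 <= j < d.+1) j%:R *: u j (pow_coef u m.-1 (d - j) v).
Proof.
elim: m d => [|m IHm] d.
  by rewrite scale0r /=; case: eqP => [->|_]; rewrite ?scale0r ?scaler0.
rewrite /= scaler_sumr.
rewrite (@eq_big_nat _ _ _ _ _ _ (fun i => i%:R *: u i (pow_coef u m (d - i) v)
   + m%:R *: \sum_(1 <= j < (d - i).+1)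
       j%:R *: u j (u i (pow_coef u m.-1 (d - i - j) v)))); last first.
  move=> i /andP[i0 ltid].
  have -> : d%:R = i%:R + (d - i)%:R :> C by rewrite -natrD subnKC // -ltnS.
  rewrite scalerDl -[(d - i)%:R *: _](linZ (u_lin i)) /= IHm.
  rewrite (linZ (u_lin i)) (lin_sum (u_lin i)) /=; congr (_ + _ *: _).
  apply: eq_big_nat => j /andP[j0 _]; rewrite (linZ (u_lin i)) /= u_comm //.
rewrite big_split /= -natr1 scalerDl scale1r addrC; congr (_ + _).
rewrite -scaler_sumr; case: m {IHm} => [|m]; first by rewrite !scale0r.
rewrite triangular_sum_swap; congr (_ *: _); apply: eq_big_nat => j /andP[j0 ltj] /=.
rewrite (lin_sum (u_lin j)) scaler_sumr; apply: eq_bigr => i _ /=.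
by rewrite subnAC.
Qed.

(** This is t d/dt exp u = (t u') exp u: for d > 0 it determines the coefficient of degree d from
    those of lower degree. *)
Lemma exp_coef_rec d v : d%:R *: exp_coef u d v =
  \sum_(1 <= j < d.+1) j%:R *: u j (exp_coef u (d - j) v).
Proof.
rewrite /exp_coef scaler_sumr.
under eq_bigr => m _ do
  rewrite scalerA mulrC -scalerA pow_coef_rec scalerA scaler_sumr.
rewrite exchange_big /=; apply: eq_big_nat => j /andP[j0 ltj].
rewrite -/(exp_coef u (d - j) v) (@exp_coef_widen d); last by lia.
rewrite big_nat_recl // mulr0 scale0r add0r.
rewrite (lin_sum (u_lin j)) scaler_sumr; apply: eq_bigr => m _ /=.
rewrite (linZ (u_lin j)) /= !scalerA factS natrM; congr (_ *: _).
have m1 : m.+1%:R != 0 :> C by rewrite pnatr_eq0.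
have mf : m`!%:R != 0 :> C by rewrite pnatr_eq0 -lt0n fact_gt0.
by move: m1 mf; move: m.+1%:R m`!%:R => a b a0 b0; field; rewrite ?a0 ?b0.
Qed.

End Family.

(* [exp_coef] with an integer index, vanishing on negative ones. *)
Definition expz (u : nat -> F -> F) (m : int) (v : F) : F :=
  if m is Posz d then exp_coef u d v else 0.

Lemma expz_linear u m : (forall j, linear (u j)) -> linear (expz u m).
Proof.
move=> u_lin; case: m => d /=; first exact: exp_coef_linear.
by move=> c v w; rewrite scaler0 addr0.
Qed.

Lemma expz_neg u m v : m < 0 -> expz u m v = 0.
Proof. by case: m. Qed.

Lemma expz_comm u U j kap : (forall i, linear (u i)) -> linear U -> (0 < j)%N ->
    (forall i v, (0 < i)%N ->
       U (u i v) = u i (U v) + (if i == j then kap else 0) *: v) ->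
  forall m v, U (expz u m v) = expz u m (U v) + kap *: expz u (m - j%:Z) v.
Proof.
move=> u_lin U_lin j0 Uu [d|d] v /=; last first.
  by rewrite (lin0 U_lin) expz_neg ?scaler0 ?addr0 //; lia.
rewrite (exp_coef_comm u_lin U_lin j0 Uu); case: leqP => [le|lt].
  by rewrite subzn.
by rewrite expz_neg //; lia.
Qed.

Lemma expz_commute u U : (forall i, linear (u i)) -> linear U ->
    (forall i v, (0 < i)%N -> U (u i v) = u i (U v)) ->
  forall m v, U (expz u m v) = expz u m (U v).
Proof.
move=> u_lin U_lin Uu m v.
rewrite (@expz_comm u U 1 0) // ?scale0r ?addr0 // => i w i0.
by rewrite if_same scale0r addr0 Uu.
Qed.

(** The terms with j > e have negative index and vanish, so a single range N serves for the
    recursion at two consecutive degrees. *)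
Lemma expz_rec u (e N : nat) v : (forall i, linear (u i)) ->
    (forall i j w, (0 < i)%N -> (0 < j)%N -> u i (u j w) = u j (u i w)) ->
    (e <= N)%N ->
  \sum_(1 <= j < N.+1) j%:R *: u j (expz u (e%:Z - j%:Z) v) = e%:R *: expz u e v.
Proof.
move=> u_lin uC leN; rewrite /= exp_coef_rec // (@big_cat_nat _ _ _ e.+1) //=.
rewrite [X in _ + X = _]big_nat_cond [X in _ + X = _]big1 ?addr0; last first.
  move=> j /andP[/andP[lej _] _]; rewrite expz_neg; last by lia.
  by rewrite (lin0 (u_lin j)) scaler0.
by apply: eq_big_nat => j /andP[_ ltj]; rewrite subzn.
Qed.

(* The contraction [exp (- sum_n (c t)^n / n) = 1 - c t]. *)
Lemma expz_exchange (an cr : nat -> F -> F) (c : C) :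
    (forall i, linear (an i)) -> (forall i, linear (cr i)) ->
    (forall i j v, (0 < i)%N -> (0 < j)%N -> an i (an j v) = an j (an i v)) ->
    (forall i j v, (0 < i)%N -> (0 < j)%N -> an i (cr j v) =
       cr j (an i v) + (if j == i then - (c ^+ i / i%:R) else 0) *: v) ->
  forall (e : nat) (d : int) v, expz an e (expz cr d v) =
    expz cr d (expz an e v) - c *: expz cr (d - 1) (expz an (e%:Z - 1) v).
Proof.
move=> an_lin cr_lin anC ancr e d v.
have anE i w m : (0 < i)%N -> i%:R *: an i (expz cr m w) =
    i%:R *: expz cr m (an i w) - c ^+ i *: expz cr (m - i%:Z) w.
  move=> i0; rewrite (@expz_comm cr (an i) i (- (c ^+ i / i%:R))) //; last first.
    by move=> j u j0; rewrite ancr.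
  rewrite scalerDr scalerA mulrN scaleNr mulrCA divff ?mulr1 //.
  by rewrite pnatr_eq0 -lt0n.
(* Strong induction on the annihilation degree: after multiplication by e+1, the recursion writes
   the exponential through [an j] and lower coefficients, to which the induction hypothesis
   applies. *)
elim/ltn_ind: e v => -[|e] IHe v.
  rewrite [expz an (0 - 1) v]expz_neg // (lin0 (expz_linear _ cr_lin)).
  by rewrite scaler0 subr0 /= !exp_coef0.
have e1 : e.+1%:R != 0 :> C by rewrite pnatr_eq0.
apply: (scalerI e1); rewrite -(@expz_rec an e.+1 e.+1) //.
pose X (j : nat) := expz cr (d - j%:Z) (expz an (e.+1%:Z - j%:Z) v).
(* Moving [an j] past both creation coefficients leaves two scalar terms, and these are consecutive
   values of c^j X_j, so they telescope. *)
rewrite (@eq_big_nat _ _ _ _ _ _ (fun j =>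
    j%:R *: expz cr d (an j (expz an (e.+1%:Z - j%:Z) v))
    - c *: (j%:R *: expz cr (d - 1) (an j (expz an (e%:Z - j%:Z) v)))
    + (c ^+ j.+1 *: X j.+1 - c ^+ j *: X j))); last first.
  move=> j /andP[j0 ltj]; rewrite subzn; last by lia.
  rewrite IHe; last by lia.
  rewrite (linB (an_lin j)) (linZ (an_lin j)) /=.
  rewrite scalerBr anE // scalerA (mulrC _ c) -scalerA anE // scalerBr.
  rewrite (scalerA c (c ^+ j)) -exprS /X -subzn; last by lia.
  have -> : d - 1 - j%:Z = d - j.+1%:Z by lia.
  have -> : e.+1%:Z - j%:Z - 1 = e%:Z - j%:Z by lia.
  have -> : e.+1%:Z - j.+1%:Z = e%:Z - j%:Z by lia.
  rewrite !opprD !opprK addrACA (addrC (- (_ *: _))).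
  by have -> : e.+1%:Z - j%:Z = (e.+1 - j)%N by lia.
(* The upper end X_(e+2) has annihilation index -1 and is 0; the lower end - c X_1 raises the
   coefficient - c e of the second sum to - c (e+1). *)
rewrite 2!big_split /= sumrN -scaler_sumr telescope_sumr // [X e.+2]/X.
rewrite [expz an (e.+1%:Z - e.+2%:Z) v]expz_neg; last by lia.
rewrite (lin0 (expz_linear _ cr_lin)) scaler0 sub0r.
have crS m (w : nat -> F) N : \sum_(1 <= j < N) j%:R *: expz cr m (w j) =
    expz cr m (\sum_(1 <= j < N) j%:R *: w j).
  rewrite (lin_sum (expz_linear m cr_lin)); apply: eq_bigr => j _ /=.
  by rewrite (linZ (expz_linear m cr_lin)).
rewrite !crS !expz_rec // !(linZ (expz_linear _ cr_lin)) /=.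
rewrite [X 1%N]/X scalerBr expr1 -addrA; congr (_ + _).
have -> : e.+1%:Z - 1 = e by lia.
rewrite -opprD; congr (- _); rewrite !scalerA -scalerDl -natr1.
by rewrite (mulrC c) mulrDl mul1r subn1.
Qed.

End ExpCoef.

Arguments expz {R F} u m v : simpl never.

(** * Normally ordered exponentials on the Fock module *)

Section Exponential.
Variable R : realType.
Local Notation C := R[i].

Lemma cexpD (u v : C) : cexp (u + v) = cexp u * cexp v.
Proof.
case: u v => [a b] [c d]; rewrite /cexp /= expRD cosD sinD.
by apply/eqP; rewrite eq_complex /=; apply/andP; split; apply/eqP; ring.
Qed.

Lemma cexp0 : cexp (0 : C) = 1.
Proof. by rewrite /cexp /= expR0 cos0 sin0 mulr0 mul1r. Qed.

Lemma cexp_neq0 (u : C) : cexp u != 0.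
Proof.
apply/eqP => u0; have := cexpD u (- u).
by rewrite subrr cexp0 u0 mul0r => /eqP; rewrite oner_eq0.
Qed.

Lemma cexpN (u : C) : cexp (- u) = (cexp u)^-1.
Proof.
by apply: (mulfI (cexp_neq0 u)); rewrite -cexpD subrr cexp0 divff ?cexp_neq0.
Qed.

Lemma cexp_ipi : cexp (ipi R) = - 1.
Proof.
rewrite /cexp /= expR0 cospi sinpi mulr0 mul1r.
by apply/eqP; rewrite eq_complex /= oppr0 !eqxx.
Qed.

End Exponential.

Section FockModule.
Variables (R : realType) (lnq k : R[i]) (F : lmodType R[i]).
Variables (x : boson -> int -> {linear F -> F}) (vac : F).
Hypothesis hF : fock_module lnq k x vac.
Local Notation C := R[i].

Definition modes (w : boson -> C) (n : int) (v : F) : F :=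
  \sum_(s <- bosons) w s *: x s n v.

Definition pairing (w w' : boson -> C) (n : int) : C :=
  \sum_(s <- bosons) \sum_(t <- bosons) w s * w' t * gram lnq k s t n.

Lemma modes_linear w n : linear (modes w n).
Proof.
move=> c u v; rewrite /modes scaler_sumr -big_split; apply: eq_bigr => s _ /=.
by rewrite linearP scalerDr !scalerA mulrC.
Qed.

Lemma modes_comm w w' m n v : m != 0 -> n != 0 ->
  modes w m (modes w' n v) = modes w' n (modes w m v)
    + (if m + n == 0 then pairing w w' m else 0) *: v.
Proof.
move=> m0 n0; apply/eqP; rewrite addrC -subr_eq; apply/eqP.
have -> : modes w m (modes w' n v) =
    \sum_(s <- bosons) \sum_(t <- bosons) (w s * w' t) *: x s m (x t n v).
  apply: eq_bigr => s _; rewrite (linear_sum (x s m)) scaler_sumr.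
  by apply: eq_bigr => t _; rewrite linearZ scalerA.
have -> : modes w' n (modes w m v) =
    \sum_(s <- bosons) \sum_(t <- bosons) (w s * w' t) *: x t n (x s m v).
  rewrite exchange_big; apply: eq_bigr => t _.
  rewrite (linear_sum (x t n)) scaler_sumr.
  by apply: eq_bigr => s _; rewrite linearZ scalerA mulrC.
rewrite -sumrB.
under eq_bigr => s _.
  rewrite -sumrB.
  under eq_bigr => t _ do rewrite -scalerBr (fock_comm hF) // scalerA.
  rewrite -scaler_suml; over.
rewrite -scaler_suml; congr (_ *: _); case: eqP => // _.
by rewrite big1 // => s _; rewrite big1 // => t _; rewrite mulr0.
Qed.

Lemma modes_commute w w' m n v : m != 0 -> n != 0 -> m + n != 0 ->
  modes w m (modes w' n v) = modes w' n (modes w m v).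
Proof. by move=> m0 n0 /negbTE mn; rewrite modes_comm // mn scale0r addr0. Qed.

(** * Local finiteness: a degree filtration without a given grading *)

Definition word_act (w : seq (boson * nat)) (v : F) : F :=
  foldr (fun p u => x p.1 p.2%:Z u) v w.

Definition word_deg (w : seq (boson * nat)) : nat := sumn (map snd w).

(* [v] has degree less than [N]: every product of annihilation modes of total
   degree at least [N] kills it. *)
Definition deg_lt (N : nat) (v : F) : Prop :=
  forall w, all (fun p => (0 < p.2)%N) w -> (N <= word_deg w)%N ->
    word_act w v = 0.

Lemma deg_lt_widen M N v : (N <= M)%N -> deg_lt N v -> deg_lt M v.
Proof. by move=> leNM vN w w0 leM; apply: vN => //; apply: leq_trans leM. Qed.

Lemma deg_lt0 v : deg_lt 0 v -> v = 0.
Proof. by move=> /(_ [::]); apply. Qed.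

Lemma word_act_linear w : linear (word_act w).
Proof. by move=> c u v; elim: w => //= p w ->; rewrite linearP. Qed.

Lemma deg_lt_linear N c u v : deg_lt N u -> deg_lt N v -> deg_lt N (c *: u + v).
Proof.
by move=> uN vN w w0 leN; rewrite word_act_linear uN // vN // scaler0 addr0.
Qed.

Lemma deg_lt_zero N : deg_lt N 0.
Proof. by move=> w _ _; rewrite (lin0 (word_act_linear w)). Qed.

Lemma deg_ltZ N c v : deg_lt N v -> deg_lt N (c *: v).
Proof. by move=> vN; rewrite -[_ *: _]addr0; apply: deg_lt_linear => //; apply: deg_lt_zero. Qed.

Lemma deg_lt_sum N (I : Type) (r : seq I) (P : pred I) (f : I -> F) :
  (forall i, P i -> deg_lt N (f i)) -> deg_lt N (\sum_(i <- r | P i) f i).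
Proof.
move=> fN; elim/big_ind: _ => //; first exact: deg_lt_zero.
by move=> u v uN vN; rewrite -[u]scale1r; apply: deg_lt_linear.
Qed.

Lemma deg_lt_x N s n v : (0 < n)%N -> deg_lt N v -> deg_lt (N - n) (x s n%:Z v).
Proof.
move=> n0 vN w w0 leN; have := vN (rcons w (s, n)).
rewrite /word_act /word_deg -cats1 foldr_cat /= map_cat sumn_cat all_cat /=.
by rewrite n0 w0 addn0 => -> //; rewrite addnC -leq_subLR.
Qed.

(** Induction on the word from its right end, the mode that acts first: commuted past the creation
    mode, it either yields a scalar times v or lowers the degree of v. *)
Lemma deg_lt_creation N s n v : (0 < n)%N -> deg_lt N v ->
  deg_lt (N + n) (x s (- n%:Z) v).
Proof.
move=> n0 vN w; elim/last_ind: w N v vN => [|w [t j] IHw] N v vN.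
  by rewrite /word_deg /=; lia.
rewrite /word_act /word_deg -cats1 foldr_cat /= map_cat sumn_cat all_cat /=.
rewrite andbT addn0 => /andP[w0 j0] leN.
have j0' : j%:Z != 0 by lia.
have n0' : - n%:Z != 0 by lia.
have /eqP := fock_comm hF t s v j0' n0'.
rewrite subr_eq => /eqP ->; rewrite -/(word_act w _) word_act_linear.
have -> : word_act w (x s (- n%:Z) (x t j%:Z v)) = 0.
  have vj := deg_lt_x t j0 vN.
  (* For j > N the truncated difference N - j is 0 and the degree count no longer suffices; there
     the vector obtained is itself 0. *)
  case: (leqP j N) => [lejN|ltNj]; first by apply: (IHw _ _ vj) => //; rewrite /word_deg; lia.
  have -> : x t j%:Z v = 0.
    by apply: deg_lt0; apply: deg_lt_widen vj; lia.
  by rewrite linear0 (lin0 (word_act_linear w)).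
rewrite addr0; case: eqP => [jn|_]; last by rewrite scale0r.
by rewrite vN ?scaler0 // /word_deg; lia.
Qed.

Lemma deg_lt_exists v : exists N, deg_lt N v.
Proof.
elim/(fock_gen hF): v => [|c u v [M uM] [N vN]|s n v n0 [N vN]].
- exists 1%N => w; elim/last_ind: w => // w [s n] _.
  rewrite /word_act -cats1 foldr_cat all_cat /= andbT => /andP[_ n0] _.
  rewrite (fock_vac hF) // -/(word_act w 0); exact: lin0 (word_act_linear w).
- exists (maxn M N); apply: deg_lt_linear.
    by apply: deg_lt_widen uM; apply: leq_maxl.
  by apply: deg_lt_widen vN; apply: leq_maxr.
- exists (N + `|n|)%N; have -> : n = - (`|n|%N)%:Z by lia.
  by rewrite abszN; apply: deg_lt_creation => //; lia.
Qed.

Lemma deg_lt_max (vs : seq F) : exists N, forall v, v \in vs -> deg_lt N v.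
Proof.
elim: vs => [|v vs [N vsN]]; first by exists 0%N.
have [M vM] := deg_lt_exists v; exists (maxn M N) => u.
rewrite inE => /predU1P[->|/vsN uN].
  by apply: deg_lt_widen vM; apply: leq_maxl.
by apply: deg_lt_widen uN; apply: leq_maxr.
Qed.

Local Notation cr := (creation x).
Local Notation an := (annihilation x).

Lemma creationE J n : cr J n = modes (fun s => J (Mode s (- n%:Z))) (- n%:Z).
Proof. by []. Qed.

Lemma annihilationE J n : an J n = modes (fun s => J (Mode s n%:Z)) n%:Z.
Proof. by []. Qed.

Lemma creation_linear J n : linear (cr J n).
Proof. exact: modes_linear. Qed.

Lemma annihilation_linear J n : linear (an J n).
Proof. exact: modes_linear. Qed.

Lemma crz_linear J m : linear (expz (cr J) m).
Proof. exact: expz_linear (creation_linear J). Qed.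

Lemma anz_linear J m : linear (expz (an J) m).
Proof. exact: expz_linear (annihilation_linear J). Qed.

Lemma creation_commute J K i j v : (0 < i)%N -> (0 < j)%N ->
  cr J i (cr K j v) = cr K j (cr J i v).
Proof. by move=> i0 j0; rewrite !creationE modes_commute //; lia. Qed.

Lemma annihilation_commute J K i j v : (0 < i)%N -> (0 < j)%N ->
  an J i (an K j v) = an K j (an J i v).
Proof. by move=> i0 j0; rewrite !annihilationE modes_commute //; lia. Qed.

Lemma crz_commute J K m n v :
  expz (cr J) m (expz (cr K) n v) = expz (cr K) n (expz (cr J) m v).
Proof.
apply: expz_commute => //; [exact: creation_linear|exact: crz_linear|].
move=> i u i0; symmetry; apply: expz_commute; [exact: creation_linear|exact: creation_linear|].
by move=> j u' j0; rewrite creation_commute.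
Qed.

Lemma anz_commute J K m n v :
  expz (an J) m (expz (an K) n v) = expz (an K) n (expz (an J) m v).
Proof.
apply: expz_commute => //; [exact: annihilation_linear|exact: anz_linear|].
move=> i u i0; symmetry; apply: expz_commute; [exact: annihilation_linear|exact: annihilation_linear|].
by move=> j u' j0; rewrite annihilation_commute.
Qed.

(* The coefficient of [w^n / z^n] in the commutator of the exponents of
   [:e^J(z):] and [:e^K(w):]. *)
Definition wick (J K : expo R) (n : nat) : C :=
  pairing (fun s => J (Mode s n%:Z)) (fun s => K (Mode s (- n%:Z))) n%:Z.

Lemma anz_crz_exchange J K c :
    (forall n, (0 < n)%N -> wick J K n = - (c ^+ n / n%:R)) ->
  forall (e : nat) (d : int) v, expz (an J) e (expz (cr K) d v) =
    expz (cr K) d (expz (an J) e v)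
    - c *: expz (cr K) (d - 1) (expz (an J) (e%:Z - 1) v).
Proof.
move=> JK; apply: expz_exchange; [exact: annihilation_linear|exact: creation_linear| |].
  by move=> i j v i0 j0; rewrite annihilation_commute.
move=> i j v i0 j0; rewrite annihilationE creationE modes_comm; [|lia|lia].
by rewrite subr_eq0 eqz_nat eq_sym; case: eqP => // ->; rewrite -JK.
Qed.

Lemma deg_lt_pow_coef J N m d v : deg_lt N v ->
  deg_lt (N - d) (pow_coef (an J) m d v).
Proof.
move=> vN; elim: m d => [|m IHm] d /=.
  by case: eqP => [->|_]; [rewrite subn0|apply: deg_lt_zero].
rewrite big_nat_cond; apply: deg_lt_sum => j /andP[/andP[j0 lejd] _].
apply: deg_lt_sum => s _; apply: deg_ltZ.
apply: deg_lt_widen (deg_lt_x s j0 (IHm (d - j)%N)); lia.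
Qed.

Lemma deg_lt_anz J N (e : nat) v : deg_lt N v -> deg_lt (N - e) (expz (an J) e v).
Proof.
by move=> vN; apply: deg_lt_sum => m _; apply: deg_ltZ; apply: deg_lt_pow_coef.
Qed.

Lemma anz_eq0 J N (e : nat) v : deg_lt N v -> (N <= e)%N -> expz (an J) e v = 0.
Proof.
move=> vN leNe; apply: deg_lt0; have := deg_lt_anz J (e:=e) vN.
by have -> : (N - e)%N = 0%N by lia.
Qed.

(** What the zero modes leave behind on the vacuum of charge lam: [logz] is the exponent of z,
    [zeros] the logarithm of a scalar, and [chg] the shift of the charge. *)
Definition logz (J : expo R) (lam : Defs.charge R) : C :=
  \sum_(t <- bosons) J (LogZ t) * zero_mode k t lam.

Definition zeros (J : expo R) (lam : Defs.charge R) : C :=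
  \sum_(t <- bosons) J (Zero t) * zero_mode k t lam.

Definition chg (J : expo R) : Defs.charge R := fun t => J (Defs.Charge t).

Lemma zero_modeD t lam mu :
  zero_mode k t (lam + mu) = zero_mode k t lam + zero_mode k t mu.
Proof. by rewrite /zero_mode -big_split; apply: eq_bigr => s _; rewrite /= -mulrDr. Qed.

Lemma logzD J lam mu : logz J (lam + mu) = logz J lam + logz J mu.
Proof.
by rewrite /logz -big_split; apply: eq_bigr => t _; rewrite /= zero_modeD mulrDr.
Qed.

Lemma zerosD J lam mu : zeros J (lam + mu) = zeros J lam + zeros J mu.
Proof.
by rewrite /zeros -big_split; apply: eq_bigr => t _; rewrite /= zero_modeD mulrDr.
Qed.

Local Notation nexp := (nexp k x).

(** Once the exponent s is fixed, the annihilation degree e forces the creation degree m + e, and e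
    is bounded by the degree of the vector. So the sum over pairs becomes an ordinary finite sum
    over e. *)
Lemma nexpE J s f mu N (m : int) : deg_lt N (f (mu - chg J)) ->
    s = logz J (mu - chg J) + m%:~R ->
  nexp J s f mu = cexp (zeros J (mu - chg J)) *:
    \sum_(0 <= e < N) expz (cr J) (m + e%:Z) (expz (an J) e (f (mu - chg J))).
Proof.
set lam := mu - chg J; set v := f lam => vN sE.
rewrite /nexp -/(chg J) -/lam -/v -/(zeros J lam); congr (_ *: _).
(* The absolute value only converts the type: [r] keeps the e with m + e nonnegative, and [expz] is
   0 for the others. *)
pose g (e : nat) := (`|(m + e%:Z)%R|%N, e).
pose r := map g (seq.filter (fun e : nat => 0 <= m + e%:Z) (index_iota 0 N)).
have inA (p : nat * nat) : (logz J lam + p.1%:R - p.2%:R == s) = (p.1%:Z == m + p.2%:Z).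
  rewrite sE -!addrA (inj_eq (addrI _)) subr_eq !pmulrn -rmorphD /=.
  by rewrite (inj_eq (@intr_inj _)).
rewrite (fsbigE r).
- rewrite /r big_map big_filter_cond big_mkcond [RHS]big_mkcond /=; apply: eq_bigr => e _.
  case: (boolP (0 <= m + e%:Z)) => [me|me]; last by rewrite expz_neg //; lia.
  rewrite /= ifT; last first.
    by rewrite in_setE; apply/eqP; rewrite -/(logz J lam) inA /=; lia.
  by rewrite /g /= -[in RHS](gez0_abs me).
- by rewrite map_inj_uniq ?filter_uniq ?iota_uniq // => i j [].
- move=> p /= /mapP[e]; rewrite mem_filter => /andP[me _] ->.
  by apply/eqP; rewrite inA /=; lia.
- move=> [d e] /= /eqP; rewrite -/(logz J lam) (inA (d, e)) /= => /eqP dE nin.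
  have leNe : (N <= e)%N.
    rewrite leqNgt; apply: contra nin => ltN; apply/mapP; exists e.
      by rewrite mem_filter mem_index_iota ltN andbT; lia.
    by rewrite /g; congr (_, _); lia.
  rewrite -[exp_coef (an J) e v]/(expz (an J) e v) (anz_eq0 _ vN) //.
  exact: lin0 (exp_coef_linear (creation_linear J) d).
Qed.

Lemma nexp_nonint J s f mu :
    (forall m : int, s != logz J (mu - chg J) + m%:~R) -> nexp J s f mu = 0.
Proof.
move=> ns; rewrite /nexp fsbig1 ?scaler0 // => -[d e] /= sE.
move: (ns (d%:Z - e%:Z)); rewrite -sE rmorphB /= -!pmulrn addrA.
by rewrite -/(chg J) /logz eqxx.
Qed.

Lemma nexp_eq0 J s f mu : f (mu - chg J) = 0 -> nexp J s f mu = 0.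
Proof.
move=> f0; rewrite /nexp -/(chg J) fsbig1 ?scaler0 // => p _.
rewrite f0 (lin0 (exp_coef_linear (annihilation_linear J) _)).
exact: lin0 (exp_coef_linear (creation_linear J) _).
Qed.

Lemma int_shiftP (s a : C) :
  (exists m : int, s = a + m%:~R) \/ (forall m : int, s != a + m%:~R).
Proof.
have [?|ns] := pselect (exists m : int, s = a + m%:~R); [by left|right=> m].
by apply/eqP => sE; apply: ns; exists m.
Qed.

(** Additivity needs the two sums over a common finite range, hence one bound N for both vectors.
    Off the coset of admissible exponents everything is 0. *)
Lemma nexp_linear J s : linear (nexp J s).
Proof.
move=> c f g; apply/funext => mu.
have [[m sE]|ns] := int_shiftP s (logz J (mu - chg J)); last first.
  rewrite !nexp_nonint //; change (0 = c *: nexp J s f mu + nexp J s g mu).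
  by rewrite !nexp_nonint // scaler0 addr0.
have [N vN] := deg_lt_max [:: f (mu - chg J); g (mu - chg J)].
have fN : deg_lt N (f (mu - chg J)) by apply: vN; rewrite !inE eqxx ?orbT.
have gN : deg_lt N (g (mu - chg J)) by apply: vN; rewrite !inE eqxx ?orbT.
change (nexp J s (c *: f + g) mu = c *: nexp J s f mu + nexp J s g mu).
rewrite !(@nexpE _ _ _ _ N m) //; last exact: deg_lt_linear.
rewrite scalerA mulrC -scalerA -scalerDr; congr (_ *: _).
rewrite scaler_sumr -big_split; apply: eq_bigr => e _ /=.
rewrite -[(c *: f + g) _]/(c *: f (mu - chg J) + g (mu - chg J)).
by rewrite (anz_linear J e) (crz_linear J (m + e%:Z)).
Qed.

(** An annihilation mode commutes with the annihilation part and meets only the creation mode of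
    index -n, so the commutator is a scalar times the coefficient at s - n. *)
Lemma nexp_modes_pos J s f mu w (n : nat) : (0 < n)%N ->
  modes w n%:Z (nexp J s f mu) = nexp J s (fun lam => modes w n%:Z (f lam)) mu
    + pairing w (fun t => J (Mode t (- n%:Z))) n%:Z *: nexp J (s - n%:R) f mu.
Proof.
move=> n0.
have [[m sE]|ns] := int_shiftP s (logz J (mu - chg J)); last first.
  rewrite !nexp_nonint ?(lin0 (modes_linear w n)) ?scaler0 ?addr0 // => m.
  rewrite subr_eq -addrA [n%:R]pmulrn -rmorphD; exact: ns.
set v := f (mu - chg J).
have [N vN] := deg_lt_max [:: v; modes w n v].
have fN : deg_lt N v by apply: vN; rewrite !inE eqxx.
have gN : deg_lt N (modes w n v) by apply: vN; rewrite !inE eqxx orbT.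
rewrite (@nexpE J s f mu N m) // (@nexpE J s _ mu N m) //.
rewrite (@nexpE J (s - n%:R) f mu N (m - n%:Z)) //; last first.
  by rewrite sE rmorphB /= -pmulrn addrA.
rewrite (linZ (modes_linear w n)) scalerA (mulrC _ (cexp _)) -scalerA -scalerDr.
congr (_ *: _); rewrite (lin_sum (modes_linear w n)) scaler_sumr -big_split.
apply: eq_bigr => e _ /=.
rewrite (@expz_comm _ _ (cr J) (modes w n) n
  (pairing w (fun t => J (Mode t (- n%:Z))) n%:Z)) //; last 3 first.
- exact: creation_linear.
- exact: modes_linear.
- move=> i u i0; rewrite creationE modes_comm; [|lia|lia].
  by rewrite subr_eq0 eqz_nat eq_sym; case: eqP => // ->.
congr (expz _ _ _ + _ *: expz _ _ _); last by lia.
apply: (@expz_commute _ _ (an J)) => //; [exact: annihilation_linear|exact: modes_linear|].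
by move=> i u i0; rewrite annihilationE modes_commute //; lia.
Qed.

Lemma sum_shift (G : nat -> F) (n N : nat) : (forall e, (e < n)%N -> G e = 0) ->
  \sum_(0 <= e < n + N) G e = \sum_(0 <= e < N) G (n + e)%N.
Proof.
move=> G0; rewrite (@big_cat_nat _ _ _ n) //=; last exact: leq_addr.
rewrite big_nat_cond big1 ?add0r; last by move=> e /andP[/andP[_ lt] _]; apply: G0.
by rewrite -{1}[n]add0n big_addn addKn; apply: eq_bigr => e _; rewrite addnC.
Qed.

Lemma sum_trunc (G : nat -> F) (N M : nat) : (N <= M)%N ->
    (forall e, (N <= e)%N -> G e = 0) ->
  \sum_(0 <= e < M) G e = \sum_(0 <= e < N) G e.
Proof.
move=> leNM G0; rewrite (@big_cat_nat _ _ _ N) //=.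
rewrite [X in _ + X]big_nat_cond [X in _ + X]big1 ?addr0 //.
by move=> e /andP[/andP[le _] _]; apply: G0.
Qed.

Lemma nexp_modes_neg J s f mu w (n : nat) : (0 < n)%N ->
  modes w (- n%:Z) (nexp J s f mu) = nexp J s (fun lam => modes w (- n%:Z) (f lam)) mu
    + pairing w (fun t => J (Mode t n%:Z)) (- n%:Z) *: nexp J (s + n%:R) f mu.
Proof.
move=> n0.
have [[m sE]|ns] := int_shiftP s (logz J (mu - chg J)); last first.
  rewrite !nexp_nonint ?(lin0 (modes_linear w _)) ?scaler0 ?addr0 // => m.
  apply: contraNneq (ns (m - n%:Z)) => sE.
  by rewrite -(addrK n%:R s) sE rmorphB /= -pmulrn addrA.
set v := f (mu - chg J).
have [N vN] := deg_lt_max [:: v; modes w (- n%:Z) v].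
have fN : deg_lt N v by apply: vN; rewrite !inE eqxx.
have gN : deg_lt N (modes w (- n%:Z) v) by apply: vN; rewrite !inE eqxx orbT.
have leN := leq_addl n N.
(* A creation mode lowers the annihilation index by n. The first n terms of the commutator then
   vanish, so the range is lengthened by n in order to have N terms after reindexing. *)
rewrite (@nexpE J s f mu (n + N) m) //; last exact: deg_lt_widen fN.
rewrite (@nexpE J s _ mu (n + N) m) //; last exact: deg_lt_widen gN.
rewrite (@nexpE J (s + n%:R) f mu N (m + n%:Z)) //; last first.
  by rewrite sE rmorphD /= -pmulrn addrA.
rewrite (linZ (modes_linear w _)) scalerA (mulrC _ (cexp _)) -scalerA -scalerDr.
congr (_ *: _); rewrite (lin_sum (modes_linear w _)) -/v.
set kap := pairing _ _ _.
rewrite (eq_bigr (fun e : nat =>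
    expz (cr J) (m + e%:Z) (expz (an J) e (modes w (- n%:Z) v))
    + kap *: expz (cr J) (m + e%:Z) (expz (an J) (e%:Z - n%:Z) v))); last first.
  move=> e _; rewrite (@expz_commute _ _ (cr J)); last 3 first.
  - exact: creation_linear.
  - exact: modes_linear.
  - by move=> i u i0; rewrite creationE modes_commute //; lia.
  rewrite (@expz_comm _ _ (an J) (modes w (- n%:Z)) n kap) //; last 3 first.
  - exact: annihilation_linear.
  - exact: modes_linear.
  - move=> i u i0; rewrite annihilationE modes_comm; [|lia|lia].
    by rewrite (addrC (- n%:Z)) subr_eq0 eqz_nat; case: eqP => // ->.
  by rewrite (linD (crz_linear J _)) (linZ (crz_linear J _)).
rewrite big_split /= -scaler_sumr; congr (_ + _ *: _).
rewrite sum_shift; last first.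
  by move=> e lt; rewrite [expz (an J) _ _]expz_neg ?(lin0 (crz_linear J _)) //; lia.
apply: eq_bigr => e _; congr (expz _ _ (expz _ _ _)); lia.
Qed.

(** The coefficient of z^m w^m' in :e^(J(z)+K(w)):, stripped of its zero modes and truncated at N.
    It is symmetric in the two fields, so the two orders of a product can be compared through it. *)
Definition normal_sum (J K : expo R) (N : nat) (m m' : int) (v : F) : F :=
  \sum_(0 <= e < N) \sum_(0 <= e' < N)
    expz (cr J) (m + e%:Z) (expz (cr K) (m' + e'%:Z)
      (expz (an J) e (expz (an K) e' v))).

Lemma normal_sumC J K N m m' v : normal_sum J K N m m' v = normal_sum K J N m' m v.
Proof.
rewrite /normal_sum exchange_big; apply: eq_bigr => e _; apply: eq_bigr => e' _.
by rewrite crz_commute anz_commute.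
Qed.

(** Wick's theorem with contraction z^l (1 - c w/z): the factor w/z takes its contribution from the
    coefficient at (m+1, m'-1). *)
Lemma nexp_mul J K c (l : int) s t f mu N (m m' : int) :
  let lam := mu - chg J - chg K in
    (forall n, (0 < n)%N -> wick J K n = - (c ^+ n / n%:R)) ->
    logz J (chg K) = l%:~R ->
    deg_lt N (f lam) ->
    s = logz J lam + l%:~R + m%:~R -> t = logz K lam + m'%:~R ->
  nexp J s (nexp K t f) mu =
    (cexp (zeros J lam) * cexp (zeros K lam) * cexp (zeros J (chg K))) *:
    (normal_sum J K N m m' (f lam) - c *: normal_sum J K N (m + 1) (m' - 1) (f lam)).
Proof.
move=> lam JK lE vN sE tE; set v := f lam.
have lamE : mu - chg J = lam + chg K by rewrite /lam subrK.
set w := nexp K t f (mu - chg J).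
have [M wM] := deg_lt_exists w.
(* The outer bound must cover the degree of the inner product as well as N, plus one because the
   contracted term uses annihilation index e - 1. Both sums are then cut back to N. *)
have wM' : deg_lt (maxn N M).+1 w by apply: deg_lt_widen wM; lia.
rewrite (@nexpE _ _ _ _ (maxn N M).+1 m) //; last by rewrite lamE logzD lE.
rewrite lamE zerosD cexpD (mulrAC _ (cexp (zeros K lam))) -[in RHS]scalerA; congr (_ *: _).
rewrite /w (@nexpE _ _ _ _ N m') ?addrK -?/v //.
rewrite (eq_bigr (fun e : nat => cexp (zeros K lam) *: \sum_(0 <= e' < N)
   (expz (cr J) (m + e%:Z) (expz (cr K) (m' + e'%:Z) (expz (an J) e (expz (an K) e' v)))
   - c *: expz (cr J) (m + e%:Z) (expz (cr K) (m' + e'%:Z - 1)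
       (expz (an J) (e%:Z - 1) (expz (an K) e' v)))))); last first.
  move=> e _; rewrite (linZ (anz_linear J e)) (linZ (crz_linear J _)); congr (_ *: _).
  rewrite (lin_sum (anz_linear J e)) (lin_sum (crz_linear J _)).
  apply: eq_bigr => e' _; rewrite (anz_crz_exchange JK).
  by rewrite (linB (crz_linear J _)) (linZ (crz_linear J _)).
rewrite -scaler_sumr; congr (_ *: _).
under eq_bigr => e _ do rewrite big_split sumrN -scaler_sumr.
rewrite big_split sumrN -scaler_sumr; congr (_ - _ *: _).
  apply: sum_trunc; first by lia.
  move=> e leNe; rewrite big1 // => e' _.
  have av : deg_lt N (expz (an K) e' v).
    by apply: deg_lt_widen (deg_lt_anz K (e := e') vN); exact: leq_subr.
  by rewrite (anz_eq0 _ av) // (lin0 (crz_linear K _)) (lin0 (crz_linear J _)).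
rewrite -add1n sum_shift; last first.
  case=> // _; rewrite big1 // => e' _.
  by rewrite (expz_neg (an J)) // (lin0 (crz_linear K _)) (lin0 (crz_linear J _)).
rewrite (@sum_trunc _ N); first last.
- move=> e leNe; rewrite big1 // => e' _.
  have av : deg_lt N (expz (an K) e' v).
    by apply: deg_lt_widen (deg_lt_anz K (e := e') vN); exact: leq_subr.
  rewrite [(1 + e)%N%:Z - 1](_ : _ = e%:Z); last by lia.
  by rewrite (anz_eq0 _ av) // (lin0 (crz_linear K _)) (lin0 (crz_linear J _)).
- by lia.
apply: eq_bigr => e _; apply: eq_bigr => e' _.
by congr (expz _ _ (expz _ _ (expz _ _ _))); lia.
Qed.

(** The same l in both orders makes the two products live on the same exponents. Outside them both
    sides are 0; inside, only scalars in front of [normal_sum] are left to compare. *)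
Lemma nexp_commute_gen J K c c' (l : int) (eps : C) s t f :
    (forall n, (0 < n)%N -> wick J K n = - (c ^+ n / n%:R)) ->
    (forall n, (0 < n)%N -> wick K J n = - (c' ^+ n / n%:R)) ->
    logz J (chg K) = l%:~R -> logz K (chg J) = l%:~R ->
    (forall N m m' v,
      cexp (zeros J (chg K)) *:
        (normal_sum J K N m m' v - c *: normal_sum J K N (m + 1) (m' - 1) v)
      = (eps * cexp (zeros K (chg J))) *:
        (normal_sum J K N (m + l) (m' - l) v
         - c' *: normal_sum J K N (m + l - 1) (m' - l + 1) v)) ->
  nexp J s (nexp K t f) = eps *: nexp K t (nexp J s f).
Proof.
move=> JK KJ lJ lK eqS; apply/funext => mu.
change (nexp J s (nexp K t f) mu = eps *: nexp K t (nexp J s f) mu).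
set lam := mu - chg J - chg K.
have lamE : mu - chg K - chg J = lam by rewrite /lam addrAC.
have [[m sE]|ns] := int_shiftP s (logz J lam + l%:~R); last first.
  rewrite nexp_nonint; last by rewrite -(subrK (chg K) (_ - _)) -/lam logzD lJ.
  rewrite nexp_eq0 ?scaler0 // nexp_nonint // lamE => m.
  by apply: contraNneq (ns (m - l)) => ->; rewrite rmorphB /= -addrA subrKC.
have [[m' tE]|nt] := int_shiftP t (logz K lam); last first.
  rewrite nexp_eq0 ?nexp_nonint ?scaler0 // -(subrK (chg J) (_ - _)) lamE logzD lK => m'.
  rewrite -addrA -rmorphD; exact: nt.
have [N vN] := deg_lt_exists (f lam).
(* In the other order the power l is split off from w instead of z, which moves the indices to m + l
   and m' - l. *)
rewrite (nexp_mul JK lJ vN sE tE) (@nexp_mul K J c' l t s f mu N (m' - l) (m + l)) ?lamE //.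
- rewrite -scalerA eqS -/lam !scalerA !(normal_sumC K J).
  by congr (_ *: _); ring.
- by rewrite rmorphB /= -addrA subrKC.
- by rewrite sE rmorphD /= [m%:~R + _]addrC addrA.
Qed.

Definition phase_exp (eps : C) (l : seq boson) (lam : Defs.charge R) : C :=
  ipi R * eps * \sum_(t <- l) zero_mode k t lam.

Lemma phase_nexp eps l J s f :
  phase k eps l (nexp J s f) =
  cexp (phase_exp eps l (chg J)) *: nexp J s (phase k eps l f).
Proof.
apply/funext => mu; rewrite /phase -/(phase_exp eps l mu).
change (cexp (phase_exp eps l mu) *: nexp J s f mu =
  cexp (phase_exp eps l (chg J)) *: nexp J s (phase k eps l f) mu).
have -> : phase_exp eps l mu = phase_exp eps l (chg J) + phase_exp eps l (mu - chg J).
  rewrite /phase_exp -mulrDr -big_split; congr (_ * _); apply: eq_bigr => t _.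
  by rewrite /= -zero_modeD addrC subrK.
rewrite cexpD -scalerA; congr (_ *: _).
have -> : nexp J s (phase k eps l f) mu =
  nexp J s (cexp (phase_exp eps l (mu - chg J)) *: f) mu by [].
by rewrite (linZ (nexp_linear J s)).
Qed.

End FockModule.

(** * Commutation of vertex operators with phases *)

Section Exchange.
Variables (R : realType) (lnq k : R[i]) (F : lmodType R[i]).
Variables (x : boson -> int -> {linear F -> F}) (vac : F).
Hypothesis hF : fock_module lnq k x vac.
Local Notation C := R[i].
Local Notation q_ := (qpow lnq).
Local Notation vexp J eps l := (fcomp (nexp k x J) (phase k eps l)).

Lemma qpowD u v : q_ (u + v) = q_ u * q_ v.
Proof. by rewrite /qpow mulrDr cexpD. Qed.

Lemma qpow0 : q_ 0 = 1.
Proof. by rewrite /qpow mulr0 cexp0. Qed.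

Lemma qpow_neq0 u : q_ u != 0.
Proof. exact: cexp_neq0. Qed.

Lemma qpowN u : q_ (- u) = (q_ u)^-1.
Proof. by rewrite /qpow mulrN cexpN. Qed.

Lemma qpowMn u n : q_ (u * n%:R) = q_ u ^+ n.
Proof.
elim: n => [|n IHn]; first by rewrite mulr0 qpow0.
by rewrite -natr1 mulrDr mulr1 qpowD IHn exprSr.
Qed.

Lemma cexp_2ipi (j : int) : cexp (ipi R * (2 * j%:~R)) = 1.
Proof.
have E (n : nat) : cexp (ipi R * (2 * n%:R)) = 1.
  elim: n => [|n IHn]; first by rewrite !mulr0 cexp0.
  rewrite -[n.+1%:R]natr1 !mulrDr cexpD IHn mul1r mulr1 (_ : 2 = 1 + 1) //.
  by rewrite mulrDr !mulr1 cexpD cexp_ipi mulrNN mulr1.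
case: j => n; first by rewrite -pmulrn E.
by rewrite NegzE mulrNz !mulrN cexpN -pmulrn E invr1.
Qed.

Lemma phase_commute eps l eps' l' (f : fock F) :
  phase k eps l (phase k eps' l' f) = phase k eps' l' (phase k eps l f).
Proof. by apply/funext => lam; rewrite /phase !scalerA mulrC. Qed.

Lemma phase_nil eps (f : fock F) : phase k eps [::] f = f.
Proof.
by apply/funext => lam; rewrite /phase big_nil mulr0 cexp0 scale1r.
Qed.

Lemma phase_linear eps l : linear (phase k eps l : fock F -> fock F).
Proof.
move=> c f g; apply/funext => lam.
change (phase k eps l (c *: f + g) lam = c *: phase k eps l f lam + phase k eps l g lam).
rewrite /phase -[(c *: f + g) lam]/(c *: f lam + g lam).
by rewrite scalerDr !scalerA mulrC.
Qed.

Lemma vexp_linear J eps l s : linear (vexp J eps l s).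
Proof. by move=> c f g; rewrite /fcomp phase_linear (nexp_linear hF). Qed.

Lemma vexp_nil J : vexp J 0 [::] = nexp k x J.
Proof. by apply/funext => s; apply/funext => f; rewrite /fcomp phase_nil. Qed.

(** Phases and exponentials are exchanged separately: each phase sees only the charge of the other
    operator, and these scalars must cancel the factor e from the exponentials. *)
Lemma vexp_commute_aux J eps l K eps' l' e s t f :
    nexp k x J s (nexp k x K t (phase k eps l (phase k eps' l' f))) =
      e *: nexp k x K t (nexp k x J s (phase k eps l (phase k eps' l' f))) ->
    cexp (phase_exp k eps l (chg K)) * e = cexp (phase_exp k eps' l' (chg J)) ->
  vexp J eps l s (vexp K eps' l' t f) = vexp K eps' l' t (vexp J eps l s f).
Proof.
move=> JK eE; rewrite /fcomp (phase_nexp hF eps l K t) (phase_nexp hF eps' l' J s).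
rewrite (linZ (nexp_linear hF J s)) (linZ (nexp_linear hF K t)) JK scalerA eE.
by rewrite [phase k eps' l' (phase k eps l f)]phase_commute.
Qed.

(** Without contraction only scalars differ. Their logarithms need to agree modulo 2 pi i, and j is
    the witness of that congruence. A vanishing contraction is the case c = 0 of 1 - c w/z. *)
Lemma vexp_commute0 J eps l K eps' l' (j : int) s t f :
    (forall n, (0 < n)%N -> wick lnq k J K n = 0) ->
    (forall n, (0 < n)%N -> wick lnq k K J n = 0) ->
    logz k J (chg K) = 0 -> logz k K (chg J) = 0 ->
    phase_exp k eps l (chg K) + zeros k J (chg K) =
      phase_exp k eps' l' (chg J) + zeros k K (chg J) + ipi R * (2 * j%:~R) ->
  vexp J eps l s (vexp K eps' l' t f) = vexp K eps' l' t (vexp J eps l s f).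
Proof.
move=> JK KJ lJ lK ze.
apply: (@vexp_commute_aux _ _ _ _ _ _
  (cexp (zeros k J (chg K)) / cexp (zeros k K (chg J)))).
  apply: (nexp_commute_gen hF (c := 0) (c' := 0) (l := 0)) => //.
  - by move=> n n0; rewrite JK // expr0n eqn0Ngt n0 mul0r oppr0.
  - by move=> n n0; rewrite KJ // expr0n eqn0Ngt n0 mul0r oppr0.
  - by move=> N m m' v; rewrite divfK ?cexp_neq0 // !scale0r !subr0 ?addr0.
rewrite mulrA -cexpD ze !cexpD cexp_2ipi mulr1 mulfK //; exact: cexp_neq0.
Qed.

(* The two orders give [w - q^g z] and [q^g z - w] up to a common factor. *)
Lemma vexp_commute1 J eps l K eps' l' (g : C) (j : int) s t f :
    (forall n, (0 < n)%N -> wick lnq k J K n = - (q_ (g * n%:R) / n%:R)) ->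
    (forall n, (0 < n)%N -> wick lnq k K J n = - (q_ (- g * n%:R) / n%:R)) ->
    logz k J (chg K) = 1 -> logz k K (chg J) = 1 ->
    phase_exp k eps l (chg K) + zeros k J (chg K) =
      phase_exp k eps' l' (chg J) + zeros k K (chg J) - lnq * g
      + ipi R * (2 * j%:~R + 1) ->
  vexp J eps l s (vexp K eps' l' t f) = vexp K eps' l' t (vexp J eps l s f).
Proof.
move=> JK KJ lJ lK ze.
have zE : cexp (phase_exp k eps l (chg K)) * cexp (zeros k J (chg K)) =
    - (q_ g)^-1 * (cexp (phase_exp k eps' l' (chg J)) * cexp (zeros k K (chg J))).
  rewrite -!cexpD ze mulrDr mulr1 cexpD [cexp (_ * _ + _)]cexpD cexp_2ipi mul1r.
  by rewrite cexp_ipi mulrN1 cexpD cexpN mulrC mulNr.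
have Q0 := qpow_neq0 g; have Z0 := cexp_neq0 (zeros k K (chg J)).
(* The factor - q^g comes from z - q^g w = - q^g (w - q^(-g) z); the odd multiple of i pi in the
   hypothesis cancels its sign. *)
apply: (@vexp_commute_aux _ _ _ _ _ _
  (- q_ g * cexp (zeros k J (chg K)) / cexp (zeros k K (chg J)))).
  apply: (nexp_commute_gen hF (c := q_ g) (c' := (q_ g)^-1) (l := 1)) => //.
  - by move=> n n0; rewrite JK // qpowMn.
  - by move=> n n0; rewrite KJ // qpowMn qpowN.
  - move=> N m m' v; rewrite divfK ?cexp_neq0 // addrK subrK.
    rewrite [- q_ g * _]mulrC -scalerA; congr (_ *: _).
    by rewrite scaleNr scalerBr scalerA divff // scale1r opprB.
rewrite mulrA (mulrCA _ (- q_ g)) zE; field; by rewrite Q0 Z0.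
Qed.

Definition commuting (X Y : fock F -> fock F) := forall f, X (Y f) = Y (X f).

Lemma commutingD X Y Y' : linear X -> commuting X Y -> commuting X Y' ->
  commuting X (Y + Y').
Proof. by move=> XL XY XY' f; rewrite /= (linD XL) XY XY'. Qed.

Lemma commutingZ X c Y : linear X -> commuting X Y -> commuting X (c *: Y).
Proof. by move=> XL XY f; rewrite /= (linZ XL) XY. Qed.

Lemma bracket_commuting p X Y : commuting X Y -> bracket false p 1 X Y = 0.
Proof.
by move=> XY; apply/funext => f; rewrite /bracket /= mul1r scale1r XY subrr.
Qed.

Lemma linear_fct_D (X Y : fock F -> fock F) : linear X -> linear Y -> linear (X + Y).
Proof.
move=> XL YL c f g; rewrite -[(X + Y) _]/(X _ + Y _) XL YL.
by rewrite addrACA -scalerDr.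
Qed.

Lemma linear_fct_Z (c : C) (X : fock F -> fock F) : linear X -> linear (c *: X).
Proof.
move=> XL d f g; rewrite -[(c *: X) _]/(c *: X _) XL.
by rewrite scalerDr !scalerA mulrC.
Qed.

Local Notation cu s kappa := (cur lnq (basic R s) kappa).
Local Notation cp s := (curp lnq (basic R s)).
Local Notation cm s := (curm lnq (basic R s)).
Local Notation qs := (qscale lnq).

(** Single exponentials with their phases, the absence of a phase being coded as (0, [::]). Any
    property stable under linear combinations then needs checking only on these. *)
Definition Xplus_terms (i : node) : seq (expo R * C * seq boson) :=
  match i with
  | N1 =>
      [:: (- cu b12 (- 1) - qs 1 (cu c_ 0), 1, [:: c_; b12]);
          (- cu b12 (- 1) - qs (- 1) (cu c_ 0), 1, [:: c_; b12])]
  | N2 =>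
      [:: (- qs 1 (cp b12) - qs 1 (cp b13) + qs 1 (cu b23 0), 1,
           [:: c_; b12; b13; b23]);
          (cu b12 0 + cu b13 0 + cu c_ 0, 0, [::])]
  end.

Definition Xminus_terms (i : node) : seq (expo R * C * seq boson) :=
  match i with
  | N1 =>
      [:: (qs ((k + 1) / 2) (cp (a_ N1)) + qs (k + 2) (cu b12 1)
           + qs (k + 2) (cp b13) - qs (k + 1) (cp b23) + qs (k + 1) (cu c_ 0),
           - 1, [:: c_; b12]);
          (qs (- (k + 1) / 2) (cm (a_ N1)) + qs (- k - 2) (cu b12 1)
           + qs (- k - 2) (cm b13) - qs (- k - 1) (cm b23)
           + qs (- k - 1) (cu c_ 0), - 1, [:: c_; b12]);
          (qs ((k + 1) / 2) (cp (a_ N1)) - qs (k + 1) (cu b13 0)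
           + qs (k + 1) (cu b23 (- 1)), 1, [:: b13; b23])]
  | N2 =>
      [:: (qs ((k + 1) / 2) (cp (a_ N2)) - qs (k + 1) (cu b23 0), - 1,
           [:: c_; b12; b13; b23]);
          (qs (- (k + 1) / 2) (cm (a_ N2)) - qs (- k - 1) (cu b23 0), - 1,
           [:: c_; b12; b13; b23]);
          (qs (- (k + 1) / 2) (cm (a_ N2)) - qs (- k - 1) (cu b12 1)
           - qs (- k - 1) (cu b13 1) - qs (- k) (cu c_ 0), 0, [::]);
          (qs (- (k + 1) / 2) (cm (a_ N2)) - qs (- k - 1) (cu b12 1)
           - qs (- k - 1) (cu b13 1) - qs (- k - 2) (cu c_ 0), 0, [::])]
  end.

Section Terms.
Variable P : (fock F -> fock F) -> Prop.
Hypothesis PD : forall X Y, P X -> P Y -> P (X + Y).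
Hypothesis PZ : forall c X, P X -> P (c *: X).

Let PB X Y : P X -> P Y -> P (X - Y).
Proof. by move=> PX PY; apply: PD => //; rewrite -scaleN1r; apply: PZ. Qed.

Lemma Xplus_ind i t :
    (forall J eps l s, List.In (J, eps, l) (Xplus_terms i) -> P (vexp J eps l s)) ->
  P (Xplus lnq k x i t).
Proof.
case: i => Pterms; rewrite /Xplus.
  apply: PZ; apply: (PB (X := vexp _ 1 [:: c_; b12] _) (Y := vexp _ 1 [:: c_; b12] _));
    apply: Pterms => /=; tauto.
rewrite -[X in _ + X]vexp_nil -scaleN1r.
apply: (PD (X := _ *: vexp _ 1 _ _) (Y := vexp _ 0 _ _)); [apply: PZ|];
  apply: Pterms => /=; tauto.
Qed.

Lemma Xminus_ind i t :
    (forall J eps l s, List.In (J, eps, l) (Xminus_terms i) -> P (vexp J eps l s)) ->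
  P (Xminus lnq k x i t).
Proof.
case: i => Pterms; rewrite /Xminus.
  set K1 := (X in nexp k x X - _); set K2 := (X in _ - nexp k x X).
  set K3 := (X in fcomp (nexp k x X) (phase k 1 [:: b13; b23])).
  apply: (PD
    (X := (q_ 1 - q_ (- 1))^-1 *: (vexp K1 (- 1) [:: c_; b12] (t - - 1)
                                  - vexp K2 (- 1) [:: c_; b12] (t - - 1)))
    (Y := q_ (k + 1) *: vexp K3 1 [:: b13; b23] t)).
    by apply: PZ; apply: PB; apply: Pterms => /=; tauto.
  by apply: PZ; apply: Pterms => /=; tauto.
set K1 := (X in fcomp (nexp k x X - _)); set K2 := (X in fcomp (_ - nexp k x X)).
set K3 := (X in _ - (nexp k x X - _)); set K4 := (X in _ - (_ - nexp k x X)).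
rewrite -(vexp_nil K3) -(vexp_nil K4).
pose l := [:: c_; b12; b13; b23].
apply: (@PZ (q_ 1 - q_ (- 1))^-1
  (q_ 1 *: (vexp K1 (- 1) l (t - - 1) - vexp K2 (- 1) l (t - - 1))
        - (vexp K3 0 [::] (t - - 1) - vexp K4 0 [::] (t - - 1)))).
by apply: PB; [apply: PZ|]; apply: PB; apply: Pterms => /=; tauto.
Qed.

End Terms.

Lemma Xplus_linear i t : linear (Xplus lnq k x i t).
Proof.
apply: (Xplus_ind (P := fun X => linear X)) => [X Y|c X|J eps l s _].
- exact: linear_fct_D.
- exact: linear_fct_Z.
- exact: vexp_linear.
Qed.

Lemma Xminus_linear i t : linear (Xminus lnq k x i t).
Proof.
apply: (Xminus_ind (P := fun X => linear X)) => [X Y|c X|J eps l s _].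
- exact: linear_fct_D.
- exact: linear_fct_Z.
- exact: vexp_linear.
Qed.

End Exchange.

(** * Contractions of the bosonized currents *)

(* [qval al nn u] is the value of the expression [u], read as a polynomial in
   the level and in [n], at the rationals [al] and [nn]. *)
Ltac qval al nn u :=
  lazymatch u with
  | (?v + ?w)%R => let a := qval al nn v in let b := qval al nn w in
      constr:(QArith.QArith_base.Qplus a b)
  | (- ?v)%R => let a := qval al nn v in constr:(QArith.QArith_base.Qopp a)
  | (?v * ?w)%R => let a := qval al nn v in let b := qval al nn w in
      constr:(QArith.QArith_base.Qmult a b)
  | (?v^-1)%R => let a := qval al nn v in constr:(QArith.QArith_base.Qinv a)
  | 1%R => constr:(QArith.QArith_base.inject_Z (BinInt.Z.of_nat 1%N))
  | 0%R => constr:(QArith.QArith_base.inject_Z (BinInt.Z.of_nat 0%N))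
  | (?m%:R)%R =>
      lazymatch m with
      | S _ => constr:(QArith.QArith_base.inject_Z (BinInt.Z.of_nat m))
      | _ => nn
      end
  | _ => al
  end.

Section Monomials.
Variables (R : realType) (lnq alpha : R[i]).
Local Notation C := R[i].

(** The integer exponents of A and H are written as differences of naturals, so that [field] sees
    only natural powers and inverses. *)
Lemma qpow_monomial (n a a' b b' : nat) (u A H : C) :
    qpow lnq (alpha * n%:R / 2) = A -> qpow lnq (n%:R / 2) = H ->
    u = (a%:R - a'%:R) * (alpha * n%:R / 2) + (b%:R - b'%:R) * (n%:R / 2) ->
  qpow lnq u = A ^+ a / A ^+ a' * (H ^+ b / H ^+ b').
Proof.
move=> <- <- ->; rewrite !mulrBl !(mulrC _%:R (_ / _)) !qpowD !qpowN.
by rewrite !qpowMn.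
Qed.

End Monomials.

(* Writes every [qpow lnq u] in the goal as a monomial in [A = q^(alpha n/2)]
   and [H = q^(n/2)]. *)
Ltac qpow_norm lnq alpha n AE HE :=
  repeat match goal with
  | |- context [@qpow ?R lnq ?u] =>
      let zero := constr:(QArith.QArith_base.inject_Z (BinInt.Z.of_nat 0%N)) in
      let two := constr:(QArith.QArith_base.inject_Z (BinInt.Z.of_nat 2%N)) in
      let one := constr:(QArith.QArith_base.inject_Z (BinInt.Z.of_nat 1%N)) in
      (* With u = a (alpha n/2) + b (n/2), the choice n = 2 gives b at alpha = 0 and a + b at alpha
         = 1. This interpolation is only a guess; the final [field] verifies it. *)
      let v0 := qval zero two u in
      let v1 := qval one two u in
      let b := eval vm_compute in
        (QArith.QArith_base.Qnum (QArith.Qreduction.Qred v0)) in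
      let a := eval vm_compute in (QArith.QArith_base.Qnum
        (QArith.Qreduction.Qred (QArith.QArith_base.Qminus v1 v0))) in
      let ap := eval vm_compute in (BinInt.Z.to_nat a) in
      let am := eval vm_compute in (BinInt.Z.to_nat (BinInt.Z.opp a)) in
      let bp := eval vm_compute in (BinInt.Z.to_nat b) in
      let bm := eval vm_compute in (BinInt.Z.to_nat (BinInt.Z.opp b)) in
      let E := fresh "E" in
      have E := @qpow_monomial R lnq alpha n ap am bp bm u _ _ AE HE;
      rewrite {}E; [|by field]
  end.

Section Modes.
Variables (R : realType) (lnq alpha : R[i]).
Local Notation C := R[i].
Local Notation q_ := (qpow lnq).
Local Notation qn := (qnum lnq).
Local Notation qs := (qscale lnq).
Local Notation cu s kappa := (cur lnq (basic R s) kappa).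
Local Notation cp s := (curp lnq (basic R s)).
Local Notation cm s := (curm lnq (basic R s)).

Lemma cur_pos o kappa s n : (0 < n)%N -> cur lnq o kappa (Mode s n%:Z) =
  - (omode o n%:Z s / qn n%:R * q_ (- kappa * n%:R)).
Proof. by case: n => // n _; rewrite /cur /= -pmulrn. Qed.

Lemma qnumN u : qn (- u) = - qn u.
Proof. by rewrite /qnum opprK -mulNr opprB. Qed.

Lemma cur_neg o kappa s n : (0 < n)%N -> cur lnq o kappa (Mode s (- n%:Z)) =
  omode o (- n%:Z) s / qn n%:R * q_ (- kappa * n%:R).
Proof.
case: n => // n _; rewrite /cur oppr_eq0 /= mulrNz -pmulrn qnumN invrN.
by rewrite mulrN mulNr opprK.
Qed.

Lemma curp_pos o s n : (0 < n)%N ->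
  curp lnq o (Mode s n%:Z) = (q_ 1 - q_ (- 1)) * omode o n%:Z s.
Proof. by case: n. Qed.

Lemma curp_neg o s n : curp lnq o (Mode s (- n%:Z)) = 0.
Proof. by case: n. Qed.

Lemma curm_pos o s n : curm lnq o (Mode s n%:Z) = 0.
Proof. by case: n. Qed.

Lemma curm_neg o s n : (0 < n)%N ->
  curm lnq o (Mode s (- n%:Z)) = - ((q_ 1 - q_ (- 1)) * omode o (- n%:Z) s).
Proof. by case: n. Qed.

Lemma qscale_pos u J s n : qs u J (Mode s n%:Z) = J (Mode s n%:Z) * q_ (- u * n%:R).
Proof. by rewrite /qscale -pmulrn. Qed.

Lemma qscale_neg u J s n :
  qs u J (Mode s (- n%:Z)) = J (Mode s (- n%:Z)) * q_ (u * n%:R).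
Proof. by rewrite /qscale mulrNz -pmulrn mulrNN. Qed.

Lemma expoD (J K : expo R) y : (J + K) y = J y + K y. Proof. by []. Qed.
Lemma expoN (J : expo R) y : (- J) y = - J y. Proof. by []. Qed.

Lemma gram_pos s t n : gram lnq alpha s t n%:Z =
  match s, t with
  | a_ N1, a_ N1 => qn (2 * n%:R) * qn ((alpha + 1) * n%:R) / n%:R
  | a_ N1, a_ N2 | a_ N2, a_ N1 => - (qn n%:R * qn ((alpha + 1) * n%:R) / n%:R)
  | b12, b12 => - (qn n%:R ^+ 2 / n%:R)
  | b13, b13 | b23, b23 | c_, c_ => qn n%:R ^+ 2 / n%:R
  | _, _ => 0
  end.
Proof.
have q0 : qn 0 = 0 by rewrite /qnum oppr0 subrr mul0r.
case: s => [[]|||| ]; case: t => [[]|||| ] //=; rewrite -?pmulrn //.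
- by rewrite mulN1r qnumN !mulNr.
- by rewrite mulN1r qnumN !mulNr.
- by rewrite mul0r q0 !mul0r.
Qed.

Lemma gram_neg s t n : gram lnq alpha s t (- n%:Z) = - gram lnq alpha s t n%:Z.
Proof.
by case: s => [[]|||| ]; case: t => [[]|||| ] /=;
  rewrite ?oppr0 // !mulrNz ?mulrN !qnumN invrN ?mulrNN ?sqrrN ?mulrN ?mulNr ?opprK.
Qed.

Lemma pairing_sym w w' n :
  pairing lnq alpha w w' n%:Z = pairing lnq alpha w' w n%:Z.
Proof.
rewrite /pairing exchange_big; apply: eq_bigr => t _; apply: eq_bigr => s _ /=.
by rewrite !gram_pos [w s * _]mulrC; case: s => [[]|||| ]; case: t => [[]|||| ].
Qed.

(* The mode coefficients of an exponent which involves [a^1], [a^2] only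
   through [a^1_n + [2n]/[n] a^2_n], and neither [b^12] nor [c]. *)
Definition vertex_modes (w : boson -> C) (n : nat) (u v13 v23 : C) : Prop :=
  forall s, w s = match s with
    | a_ N1 => u
    | a_ N2 => qn (2 * n%:R) / qn n%:R * u
    | b13 => v13
    | b23 => v23
    | _ => 0
    end.

(** The orthogonality at work: against a^1 the combination gives [2n] - ([2n]/[n]) [n] = 0, and
    against a^2 only its a^1 part counts, since the diagonal Cartan entry of node 2 is 0. *)
Lemma pairing_vertex w w' n u v13 v23 : qn n%:R != 0 ->
    vertex_modes w n u v13 v23 ->
  pairing lnq alpha w w' n%:Z =
    (v13 * w' b13 + v23 * w' b23) * qn n%:R ^+ 2 / n%:R
    - u * w' (a_ N2) * (qn n%:R * qn ((alpha + 1) * n%:R) / n%:R).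
Proof.
move=> n0 wE; rewrite /pairing /bosons !big_cons !big_nil !gram_pos !wE.
rewrite !(mul0r, mulr0, add0r, addr0).
by move: (qn (2 * n%:R)) (qn ((alpha + 1) * n%:R)) ((n%:R : C)^-1) => p r m; field.
Qed.

Lemma pairing_neg w w' n :
  pairing lnq alpha w w' (- n%:Z) = - pairing lnq alpha w w' n%:Z.
Proof.
rewrite /pairing -sumrN; apply: eq_bigr => s _; rewrite -sumrN.
by apply: eq_bigr => t _; rewrite gram_neg mulrN.
Qed.

Lemma zero_modeE (lam : Defs.charge R) s : zero_mode alpha s lam =
  match s with
  | a_ N1 => (alpha + 1) * (2 * lam (a_ N1) - lam (a_ N2))
  | a_ N2 => - (alpha + 1) * lam (a_ N1)
  | b12 => - lam b12
  | t => lam t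
  end.
Proof.
by rewrite /zero_mode /bosons !big_cons !big_nil; case: s => [[]|||| ] /=; ring.
Qed.

(* The zero-mode coefficients of [:e^J(q^g z):], where [J] involves [a^1], [a^2]
   only through [a^1_0 + 2 a^2_0], and neither [b^12] nor [c]. *)
Definition vertex_zeros (J : expo R) (g u v13 v23 : C) : Prop :=
  let w s := match s with
    | a_ N1 => u | a_ N2 => 2 * u | b13 => v13 | b23 => v23 | _ => 0
    end in
  [/\ forall s, J (LogZ s) = w s, forall s, J (Defs.Charge s) = w s
    & forall s, J (Zero s) = lnq * g * w s].

Section VertexZeros.
Variables (J : expo R) (g u v13 v23 : C).
Hypothesis J0 : vertex_zeros J g u v13 v23.

(** The same cancellation for zero modes: a^1_0 acts through 2 u - 2 u = 0. *)
Lemma zero_mode_vertex s : zero_mode alpha s (chg J) =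
  match s with
  | a_ N2 => - (alpha + 1) * u | b13 => v13 | b23 => v23 | _ => 0
  end.
Proof.
rewrite zero_modeE /chg; have [_ C0 _] := J0.
by case: s => [[]|||| ]; rewrite !C0; ring.
Qed.

Lemma logz_vertex_l lam : logz alpha J lam =
  v13 * lam b13 + v23 * lam b23 - (alpha + 1) * u * lam (a_ N2).
Proof.
rewrite /logz /bosons !big_cons !big_nil !zero_modeE.
have [C0 _ _] := J0.
by rewrite !C0; ring.
Qed.

Lemma zeros_vertex_l lam : zeros alpha J lam =
  lnq * g * (v13 * lam b13 + v23 * lam b23 - (alpha + 1) * u * lam (a_ N2)).
Proof.
rewrite /zeros /bosons !big_cons !big_nil !zero_modeE.
have [_ _ C0] := J0.
by rewrite !C0; ring.
Qed.

Lemma logz_vertex_r K : logz alpha K (chg J) =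
  v13 * K (LogZ b13) + v23 * K (LogZ b23) - (alpha + 1) * u * K (LogZ (a_ N2)).
Proof.
by rewrite /logz /bosons !big_cons !big_nil !zero_mode_vertex; ring.
Qed.

Lemma zeros_vertex_r K : zeros alpha K (chg J) =
  v13 * K (Zero b13) + v23 * K (Zero b23) - (alpha + 1) * u * K (Zero (a_ N2)).
Proof.
by rewrite /zeros /bosons !big_cons !big_nil !zero_mode_vertex; ring.
Qed.

End VertexZeros.

Lemma qnum_neq0_sqr u : qn u != 0 -> q_ u ^+ 2 - 1 != 0.
Proof.
apply: contraNneq => e; rewrite /qnum qpowN; have q0 := qpow_neq0 lnq u.
have -> : q_ u - (q_ u)^-1 = (q_ u ^+ 2 - 1) / q_ u by field.
by rewrite e !mul0r.
Qed.

Lemma qnum_neq0_den u : qn u != 0 -> q_ 1 - q_ (- 1) != 0.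
Proof. by rewrite /qnum mulf_eq0 negb_or invr_eq0 => /andP[]. Qed.

End Modes.

Definition mode_simp := (expoD, expoN, qscale_pos, qscale_neg, curp_neg,
  curm_pos).

Lemma natf0 (R : realType) n : (0 < n)%N -> n%:R != 0 :> R[i].
Proof. by rewrite pnatr_eq0 -lt0n. Qed.

(** Nonvanishing of [n] and, in the next lemma, of [(alpha+1) n], in the polynomial form in which
    [field] returns its denominators. *)
Lemma qnum_halfE (R : realType) (lnq u A : R[i]) :
  qpow lnq (u / 2) = A -> qnum lnq u != 0 -> (A * A) ^+ 2 - 1 != 0.
Proof.
by move=> <- /qnum_neq0_sqr; rewrite -qpowD; have -> : u / 2 + u / 2 = u by field.
Qed.

Lemma qnum_halfDE (R : realType) (lnq a n A H : R[i]) :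
  qpow lnq (a * n / 2) = A -> qpow lnq (n / 2) = H ->
  qnum lnq ((a + 1) * n) != 0 -> (A * H * (A * H)) ^+ 2 - 1 != 0.
Proof.
move=> <- <- /qnum_neq0_sqr; rewrite -!qpowD.
by have -> : a * n / 2 + n / 2 + (a * n / 2 + n / 2) = (a + 1) * n by field.
Qed.

Ltac neq0_up_to_ring h :=
  match type of h with
  | is_true (?Y != _) =>
      match goal with
      | |- is_true (?X != _) =>
          first [have -> : X = Y by ring
                |have -> : X = - Y by ring];
          rewrite ?oppr_eq0; exact: h
      end
  end.

(** Every identity becomes one of rational functions in A, H, n and D = q - q^(-1). D is abstracted
    first, because its exponents do not scale with n and it is no monomial in A and H. *)
Ltac qnum_field lnq alpha n n0 hn hk :=
  let AE := fresh in let A := fresh "A" in let HE := fresh in let H := fresh "H" in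
  let D := fresh "D" in
  have := qpow_neq0 lnq (n%:R / 2); have := qpow_neq0 lnq (alpha * n%:R / 2);
  have := natf0 _ n0; have := qnum_neq0_den hn;
  move AE : (qpow lnq (alpha * n%:R / 2)) => A; move HE : (qpow lnq (n%:R / 2)) => H;
  have := qnum_halfE HE hn; have := qnum_halfDE AE HE hk;
  rewrite /qnum;
  move: (qpow lnq 1 - qpow lnq (- 1)) => D;
  qpow_norm lnq alpha n AE HE;
  let h1 := fresh in let h2 := fresh in let h3 := fresh in
  let h4 := fresh in let h5 := fresh in let h6 := fresh in
  move=> h1 h2 h3 h4 h5 h6; field;
  rewrite ?h1 ?h2 ?h3 ?h4 ?h5 ?h6 //=; repeat (apply/andP; split);
  solve [neq0_up_to_ring h1|neq0_up_to_ring h2].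

Ltac mode_eval n0 :=
  rewrite ?mode_simp ?(cur_pos, cur_neg, curp_pos, curm_neg, n0) //=;
  rewrite ?(mul0r, mulr0, oppr0, addr0, add0r, abszN, absz_nat).

Ltac zero_calc alpha zerosE alpha1_neq0 :=
  rewrite ?(logz_vertex_l alpha zerosE) ?(zeros_vertex_l alpha zerosE)
    ?(logz_vertex_r alpha zerosE) ?(zeros_vertex_r alpha zerosE) /phase_exp ?big_cons ?big_nil
    ?(zero_mode_vertex alpha zerosE) ?zero_modeE /chg ?(expoD, expoN) /=;
  by field; rewrite ?alpha1_neq0.

Section Vertices.
Variables (R : realType) (lnq alpha : R[i]) (F : lmodType R[i]).
Variables (x : boson -> int -> {linear F -> F}) (vac : F).
Hypothesis alpha1_neq0 : alpha + 1 != 0.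
Hypothesis qnum_neq0 : forall n, (0 < n)%N -> qnum lnq n%:R != 0.
Hypothesis qnumD_neq0 : forall n, (0 < n)%N -> qnum lnq ((alpha + 1) * n%:R) != 0.
Hypothesis hF : fock_module lnq alpha x vac.
Local Notation C := R[i].
Local Notation q_ := (qpow lnq).
Local Notation qn := (qnum lnq).
Local Notation qs := (qscale lnq).
Local Notation vexp J eps l := (fcomp (nexp alpha x J) (phase alpha eps l)).

Definition phi4_exp : expo R :=
  - qs (alpha + 1) (cur lnq (Astar lnq) (- alpha / 2)).
Definition phis1_exp : expo R :=
  qs alpha (cur lnq (Bstar lnq alpha) (- alpha / 2)).
Definition psi1_exp : expo R :=
  - qs alpha (cur lnq (Btilde lnq alpha) (alpha / 2)).
Definition psis4_exp : expo R :=
  qs (alpha - 1) (cur lnq (Atilde lnq alpha) (alpha / 2)).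

Local Notation ratioA n := (qn (alpha * n%:R) / qn ((alpha + 1) * n%:R)).

Ltac vertex_calc n n0 :=
  let h1 := fresh in let h2 := fresh in let s := fresh in
  have h1 := qnum_neq0 n0; have h2 := qnumD_neq0 n0;
  move=> s; case: s => [[]|||| ]; mode_eval n0;
  rewrite /ratio2 /Defs.ratioA ?oppr_eq0 ?eqz_nat ?gtn_eqF // ?mulrNz -?pmulrn;
  qnum_field lnq alpha n n0 h1 h2.

Lemma phi4_modes_pos n : (0 < n)%N ->
  vertex_modes lnq (fun s => phi4_exp (Mode s n%:Z)) n
    (- (q_ (- (alpha + 1) / 2 * n%:R) / qn n%:R)) 0 0.
Proof. by move=> n0; rewrite /phi4_exp; vertex_calc n n0. Qed.

Lemma phi4_modes_neg n : (0 < n)%N ->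
  vertex_modes lnq (fun s => phi4_exp (Mode s (- n%:Z))) n
    (q_ ((alpha + 1) * 3 / 2 * n%:R) / qn n%:R) 0 0.
Proof. by move=> n0; rewrite /phi4_exp; vertex_calc n n0. Qed.

Lemma phis1_modes_pos n : (0 < n)%N ->
  vertex_modes lnq (fun s => phis1_exp (Mode s n%:Z)) n
    (ratioA n * q_ ((1 - alpha) / 2 * n%:R) / qn n%:R) 0 0.
Proof. by move=> n0; rewrite /phis1_exp; vertex_calc n n0. Qed.

Lemma phis1_modes_neg n : (0 < n)%N ->
  vertex_modes lnq (fun s => phis1_exp (Mode s (- n%:Z))) n
    (- (ratioA n * q_ ((3 * alpha + 1) / 2 * n%:R) / qn n%:R)) 0 0.
Proof. by move=> n0; rewrite /phis1_exp; vertex_calc n n0. Qed.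

Lemma psi1_modes_pos n : (0 < n)%N ->
  vertex_modes lnq (fun s => psi1_exp (Mode s n%:Z)) n
    (- (q_ (- (3 * alpha + 1) / 2 * n%:R) / qn n%:R))
    (q_ (- 2 * alpha * n%:R) / qn n%:R)
    (q_ (- (2 * alpha + 1) * n%:R) / qn n%:R).
Proof. by move=> n0; rewrite /psi1_exp; vertex_calc n n0. Qed.

Lemma psi1_modes_neg n : (0 < n)%N ->
  vertex_modes lnq (fun s => psi1_exp (Mode s (- n%:Z))) n
    (q_ ((alpha - 1) / 2 * n%:R) / qn n%:R)
    (- (qn n%:R)^-1) (- (q_ (- n%:R) / qn n%:R)).
Proof. by move=> n0; rewrite /psi1_exp; vertex_calc n n0. Qed.

Lemma psis4_modes_pos n : (0 < n)%N ->
  vertex_modes lnq (fun s => psis4_exp (Mode s n%:Z)) n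
    (ratioA n * q_ ((1 - 3 * alpha) / 2 * n%:R) / qn n%:R)
    (q_ (2 * n%:R) / qn n%:R) (q_ n%:R / qn n%:R).
Proof. by move=> n0; rewrite /psis4_exp; vertex_calc n n0. Qed.

Lemma psis4_modes_neg n : (0 < n)%N ->
  vertex_modes lnq (fun s => psis4_exp (Mode s (- n%:Z))) n
    (- (ratioA n * q_ ((alpha - 3) / 2 * n%:R) / qn n%:R))
    (- (q_ (2 * alpha * n%:R) / qn n%:R))
    (- (q_ ((2 * alpha - 1) * n%:R) / qn n%:R)).
Proof. by move=> n0; rewrite /psis4_exp; vertex_calc n n0. Qed.

Ltac vertex_zeros_calc :=
  let s := fresh in
  split=> s; rewrite ?(expoD, expoN); case: s => [[]|||| ];
  rewrite /= /ratio2 /Defs.ratioA ?eqxx ?(oppr0, mul0r, mulr0, qpow0);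
  by field; rewrite ?alpha1_neq0.

Lemma phi4_zeros : vertex_zeros lnq phi4_exp (alpha + 1) 1 0 0.
Proof. by rewrite /phi4_exp; vertex_zeros_calc. Qed.

Lemma phis1_zeros : vertex_zeros lnq phis1_exp alpha (- (alpha / (alpha + 1))) 0 0.
Proof. by rewrite /phis1_exp; vertex_zeros_calc. Qed.

Lemma psi1_zeros : vertex_zeros lnq psi1_exp alpha 1 (- 1) (- 1).
Proof. by rewrite /psi1_exp; vertex_zeros_calc. Qed.

Lemma psis4_zeros : vertex_zeros lnq psis4_exp (alpha - 1) (- (alpha / (alpha + 1))) (- 1) (- 1).
Proof. by rewrite /psis4_exp; vertex_zeros_calc. Qed.

Ltac pairing_calc n n0 modesE :=
  let h1 := fresh in let h2 := fresh in
  have h1 := qnum_neq0 n0; have h2 := qnumD_neq0 n0;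
  rewrite (pairing_vertex _ _ h1 (modesE n n0)); mode_eval n0;
  try reflexivity; qnum_field lnq alpha n n0 h1 h2.

Ltac wick_calc modes_pos modes_neg zerosE :=
  [> let n := fresh "n" in let n0 := fresh "n0" in
     intros n n0; rewrite /wick; pairing_calc n n0 modes_pos
  |  let n := fresh "n" in let n0 := fresh "n0" in
     intros n n0; rewrite /wick pairing_sym; pairing_calc n n0 modes_neg
  |  zero_calc alpha zerosE alpha1_neq0 ..].

Ltac commute0_calc j modes_pos modes_neg zerosE :=
  apply: (@vexp_commute0 _ _ _ _ _ _ hF _ _ _ _ _ _ j);
  wick_calc modes_pos modes_neg zerosE.

Ltac commute1_calc g j modes_pos modes_neg zerosE :=
  apply: (@vexp_commute1 _ _ _ _ _ _ hF _ _ _ _ _ _ g j);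
  wick_calc modes_pos modes_neg zerosE.

(** The currents X^{+,i} involve only b and c oscillators, the exponent of phi_4 only a^1 and a^2,
    so there are neither contractions nor scalars. The same holds for the next lemma. *)
Lemma phi4_commute i K eps l s t f :
    List.In (K, eps, l) (Xplus_terms lnq i) ->
  vexp phi4_exp 0 [::] s (vexp K eps l t f) =
    vexp K eps l t (vexp phi4_exp 0 [::] s f).
Proof.
case: i => /= -[[<- <- <-]|[[<- <- <-]|[]]];
  commute0_calc (0 : int) phi4_modes_pos phi4_modes_neg phi4_zeros.
Qed.

Lemma phis1_commute i K eps l s t f :
    List.In (K, eps, l) (Xplus_terms lnq i) ->
  vexp phis1_exp 0 [::] s (vexp K eps l t f) =
    vexp K eps l t (vexp phis1_exp 0 [::] s f).
Proof.
case: i => /= -[[<- <- <-]|[[<- <- <-]|[]]];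
  commute0_calc (0 : int) phis1_modes_pos phis1_modes_neg phis1_zeros.
Qed.

(** In X^{-,1} the b^13 and b^23 parts have opposite signs, and the relative factor q^(-|m|) in the
    exponent of psi_1 makes their contractions cancel. In X^{-,2} each term carries exactly one of
    e^(-Q_b13), e^(-Q_b23), which leaves one linear factor. *)
Lemma psi1_commute i K eps l s t f :
    List.In (K, eps, l) (Xminus_terms lnq alpha i) ->
  vexp psi1_exp 1 [:: b13; b23] s (vexp K eps l t f) =
    vexp K eps l t (vexp psi1_exp 1 [:: b13; b23] s f).
Proof.
case: i => /=.
  case=> [[<- <- <-]|[[<- <- <-]|[[<- <- <-]|[]]]].
  - commute0_calc (0 : int) psi1_modes_pos psi1_modes_neg psi1_zeros.
  - commute0_calc (0 : int) psi1_modes_pos psi1_modes_neg psi1_zeros.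
  (* Here the current has the phase in b^13_0 + b^23_0, which takes the value -2 on the charge of
     psi_1; j = 1 undoes this full turn. *)
  - commute0_calc (1 : int) psi1_modes_pos psi1_modes_neg psi1_zeros.
case=> [[<- <- <-]|[[<- <- <-]|[[<- <- <-]|[[<- <- <-]|[]]]]].
(* In units of i pi: the phase of psi_1 on -Q_b23 gives -1, that of the current gives 2, and -1 = 2
   + 2j + 1. The last two terms have no phase, so there -1 = 2j + 1. *)
- commute1_calc (- alpha) (- 2 : int) psi1_modes_pos psi1_modes_neg psi1_zeros.
- commute1_calc (- alpha) (- 2 : int) psi1_modes_pos psi1_modes_neg psi1_zeros.
- commute1_calc (- alpha) (- 1 : int) psi1_modes_pos psi1_modes_neg psi1_zeros.
- commute1_calc (- alpha) (- 1 : int) psi1_modes_pos psi1_modes_neg psi1_zeros.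
Qed.

Lemma psis4_commute i K eps l s t f :
    List.In (K, eps, l) (Xminus_terms lnq alpha i) ->
  vexp psis4_exp 1 [:: b13; b23] s (vexp K eps l t f) =
    vexp K eps l t (vexp psis4_exp 1 [:: b13; b23] s f).
Proof.
case: i => /=.
  case=> [[<- <- <-]|[[<- <- <-]|[[<- <- <-]|[]]]].
  - commute0_calc (0 : int) psis4_modes_pos psis4_modes_neg psis4_zeros.
  - commute0_calc (0 : int) psis4_modes_pos psis4_modes_neg psis4_zeros.
  - commute0_calc (1 : int) psis4_modes_pos psis4_modes_neg psis4_zeros.
case=> [[<- <- <-]|[[<- <- <-]|[[<- <- <-]|[[<- <- <-]|[]]]]].
(* The zero of the contraction depends on the term. In the first, a^2_+ has no creation modes and
   b^23 alone gives - q^((alpha+2)n)/n. In the others a^2_- contributes (q^(-alpha n) - q^(-3 alpha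
   n))/n, which turns the - q^(-alpha n)/n of b^23 or b^13 into - q^(-3 alpha n)/n. *)
- commute1_calc (alpha + 2) (- 2 : int) psis4_modes_pos psis4_modes_neg psis4_zeros.
- commute1_calc (- 3 * alpha) (- 2 : int) psis4_modes_pos psis4_modes_neg psis4_zeros.
- commute1_calc (- 3 * alpha) (- 1 : int) psis4_modes_pos psis4_modes_neg psis4_zeros.
- commute1_calc (- 3 * alpha) (- 1 : int) psis4_modes_pos psis4_modes_neg psis4_zeros.
Qed.

End Vertices.

(** * The Cartan modes *)

Section CartanCurrents.
Variables (R : realType) (lnq alpha : R[i]) (F : lmodType R[i]).
Variables (x : boson -> int -> {linear F -> F}) (vac : F).
Hypothesis hF : fock_module lnq alpha x vac.
Local Notation C := R[i].
Local Notation q_ := (qpow lnq).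
Local Notation vexp J eps l := (fcomp (nexp alpha x J) (phase alpha eps l)).

Lemma h_mode_phase i (m : int) eps l f : m != 0 ->
  h_mode lnq alpha x i m (phase alpha eps l f) =
  phase alpha eps l (h_mode lnq alpha x i m f).
Proof.
move=> /negbTE m0; apply/funext => lam; rewrite /h_mode m0 /phase.
exact: linZ (modes_linear x (h_coef lnq alpha i m) m) _ _.
Qed.

Lemma h_mode_nexp i (m : int) J s f mu : m != 0 ->
  h_mode lnq alpha x i m (nexp alpha x J s f) mu =
  modes x (h_coef lnq alpha i m) m (nexp alpha x J s f mu).
Proof. by move=> /negbTE m0; rewrite /h_mode m0. Qed.

Lemma nexp_h_mode i (m : int) J s f mu : m != 0 ->
  nexp alpha x J s (h_mode lnq alpha x i m f) mu =
  nexp alpha x J s (fun lam => modes x (h_coef lnq alpha i m) m (f lam)) mu.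
Proof. by move=> /negbTE m0; rewrite /nexp /h_mode m0. Qed.

(** A nonzero mode of h^i preserves the charge and so passes through the phase. The factor z^n of
    the relation appears as a shift of the exponent. *)
Lemma bracket_h_pos i n J eps l s kap : (0 < n)%N ->
    pairing lnq alpha (h_coef lnq alpha i n%:Z) (fun t => J (Mode t (- n%:Z))) n%:Z
      = kap ->
  bracket false false 1 (h_mode lnq alpha x i n%:Z) (vexp J eps l s) =
    kap *: zmul n%:R (vexp J eps l) s.
Proof.
move=> n0 <-; apply/funext => f; apply/funext => mu.
have nz : n%:Z != 0 by lia.
rewrite /bracket /= mul1r scale1r /zmul /fcomp -h_mode_phase //.
set g := phase alpha eps l f.
change (h_mode lnq alpha x i n (nexp alpha x J s g) mu
  - nexp alpha x J s (h_mode lnq alpha x i n g) mu =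
  pairing lnq alpha (h_coef lnq alpha i n) (fun t => J (Mode t (- n%:Z))) n
    *: nexp alpha x J (s - n%:R) g mu).
by rewrite h_mode_nexp // nexp_h_mode // (nexp_modes_pos hF) // addrC addKr.
Qed.

Lemma bracket_h_neg i n J eps l s kap : (0 < n)%N ->
    pairing lnq alpha (h_coef lnq alpha i (- n%:Z)) (fun t => J (Mode t n%:Z)) (- n%:Z)
      = kap ->
  bracket false false 1 (h_mode lnq alpha x i (- n%:Z)) (vexp J eps l s) =
    kap *: zmul (- n%:R) (vexp J eps l) s.
Proof.
move=> n0 <-; apply/funext => f; apply/funext => mu.
have nz : - n%:Z != 0 by lia.
rewrite /bracket /= mul1r scale1r /zmul /fcomp -h_mode_phase // opprK.
set g := phase alpha eps l f.
change (h_mode lnq alpha x i (- n%:Z) (nexp alpha x J s g) mu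
  - nexp alpha x J s (h_mode lnq alpha x i (- n%:Z) g) mu =
  pairing lnq alpha (h_coef lnq alpha i (- n%:Z)) (fun t => J (Mode t n%:Z)) (- n%:Z)
    *: nexp alpha x J (s + n%:R) g mu).
by rewrite h_mode_nexp // nexp_h_mode // (nexp_modes_neg hF) // addrC addKr.
Qed.

Definition h0_weight (i : node) (lam : Defs.charge R) : C :=
  \sum_(s <- bosons) h_coef lnq alpha i 0 s * zero_mode alpha s lam.

Lemma h0_weightD i lam mu : h0_weight i (lam + mu) = h0_weight i lam + h0_weight i mu.
Proof.
rewrite /h0_weight -big_split; apply: eq_bigr => s _ /=.
by rewrite zero_modeD mulrDr.
Qed.

Lemma qh0_vexp i J eps l s r : h0_weight i (chg J) = r ->
  @qh0 R lnq alpha F i 1 \o vexp J eps l s \o @qh0 R lnq alpha F i (- 1) =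
    q_ r *: vexp J eps l s.
Proof.
move=> <-; apply/funext => f; apply/funext => mu.
change (q_ (1 * h0_weight i mu) *:
    nexp alpha x J s (phase alpha eps l (@qh0 R lnq alpha F i (- 1) f)) mu
  = q_ (h0_weight i (chg J)) *: nexp alpha x J s (phase alpha eps l f) mu).
(* At mu the exponential reads its argument only in the sector mu - chg J, where q^(-h_0) is a
   scalar. Using that scalar in all sectors makes linearity applicable. *)
pose g : fock F := q_ (- h0_weight i (mu - chg J)) *: phase alpha eps l f.
have -> : nexp alpha x J s (phase alpha eps l (@qh0 R lnq alpha F i (- 1) f)) mu =
    nexp alpha x J s g mu.
  rewrite /nexp; set v := phase _ _ _ _ _; set v' := g _.
  suff -> : v = v' by [].
  rewrite /v /v' /g /phase /qh0 -/(h0_weight i _).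
  change (cexp (ipi R * eps * (\sum_(t <- l) zero_mode alpha t (mu - chg J))) *:
      (q_ (- 1 * h0_weight i (mu - chg J)) *: f (mu - chg J)) =
    q_ (- h0_weight i (mu - chg J)) *:
      (cexp (ipi R * eps * (\sum_(t <- l) zero_mode alpha t (mu - chg J))) *: f (mu - chg J))).
  by rewrite mulN1r !scalerA mulrC.
rewrite /g (linZ (nexp_linear hF J s)).
change (q_ (1 * h0_weight i mu) *: (q_ (- h0_weight i (mu - chg J)) *:
    nexp alpha x J s (phase alpha eps l f) mu)
  = q_ (h0_weight i (chg J)) *: nexp alpha x J s (phase alpha eps l f) mu).
rewrite scalerA -qpowD; congr (q_ _ *: _).
have := h0_weightD i (mu - chg J) (chg J); rewrite subrK mul1r => ->.
by rewrite addrAC subrr add0r.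
Qed.

End CartanCurrents.

(** * Recursions and contour integrals *)

Section Recursions.
Variables (R : realType) (lnq k : R[i]) (F : lmodType R[i]).
Variables (x : boson -> int -> {linear F -> F}) (vac : F).
Hypothesis hF : fock_module lnq k x vac.
Local Notation C := R[i].

(** Pulls out the constants accumulated by earlier recursion steps. In the second product Y acts
    after X, which is where linearity of the currents enters. *)
Lemma bracketZl p p' (xi c : C) (X Y : fock F -> fock F) : linear Y ->
  bracket p p' xi (c *: X) Y = c *: bracket p p' xi X Y.
Proof.
move=> YL; apply/funext => f; rewrite /bracket.
change (c *: X (Y f) - ((- 1) ^+ (p && p') * xi) *: Y (c *: X f) =
  c *: (X (Y f) - ((- 1) ^+ (p && p') * xi) *: Y (X f))).
by rewrite (linZ YL) scalerBr !scalerA [c * _]mulrC.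
Qed.

Lemma e_genE i : e_gen lnq k x i = Xplus lnq k x i (- 1).
Proof. by rewrite /e_gen /mode mulr0z oppr0 sub0r. Qed.

Lemma f_genE i : f_gen lnq k x i = Xminus lnq k x i (- 1).
Proof. by rewrite /f_gen /mode mulr0z oppr0 sub0r. Qed.

End Recursions.

(** * Relations of the four vertex operators with the Cartan modes and the currents *)

Section Relations.
Variables (R : realType) (lnq alpha : R[i]) (F : lmodType R[i]).
Variables (x : boson -> int -> {linear F -> F}) (vac : F).
Hypothesis alpha1_neq0 : alpha + 1 != 0.
Hypothesis qnum_neq0 : forall n, (0 < n)%N -> qnum lnq n%:R != 0.
Hypothesis qnumD_neq0 : forall n, (0 < n)%N -> qnum lnq ((alpha + 1) * n%:R) != 0.
Hypothesis hF : fock_module lnq alpha x vac.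
Local Notation C := R[i].
Local Notation q_ := (qpow lnq).
Local Notation qn := (qnum lnq).
Local Notation vexp J eps l := (fcomp (nexp alpha x J) (phase alpha eps l)).
Local Notation delta2 i := ((is2 i)%:R : C).
Local Notation h_pos i J n := (pairing lnq alpha (h_coef lnq alpha i n%:Z)
  (fun t => J (Mode t (- n%:Z))) n%:Z).
Local Notation h_neg i J n := (pairing lnq alpha (h_coef lnq alpha i (- n%:Z))
  (fun t => J (Mode t n%:Z)) (- n%:Z)).

Lemma bracket_Xplus J eps l i p :
    (forall K eps' l' s t f, List.In (K, eps', l') (Xplus_terms lnq i) ->
       vexp J eps l s (vexp K eps' l' t f) = vexp K eps' l' t (vexp J eps l s f)) ->
  forall s t, bracket false p 1 (vexp J eps l s) (Xplus lnq alpha x i t) = 0.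
Proof.
move=> JX s t; apply: bracket_commuting; have JL := vexp_linear hF J eps l s.
apply: (Xplus_ind (P := commuting (vexp J eps l s))) => [X Y|c X|K e l' u Kin f].
- exact: commutingD.
- exact: commutingZ.
- exact: JX.
Qed.

Lemma bracket_Xminus J eps l i p :
    (forall K eps' l' s t f, List.In (K, eps', l') (Xminus_terms lnq alpha i) ->
       vexp J eps l s (vexp K eps' l' t f) = vexp K eps' l' t (vexp J eps l s f)) ->
  forall s t, bracket false p 1 (vexp J eps l s) (Xminus lnq alpha x i t) = 0.
Proof.
move=> JX s t; apply: bracket_commuting; have JL := vexp_linear hF J eps l s.
apply: (Xminus_ind (P := commuting (vexp J eps l s))) => [X Y|c X|K e l' u Kin f].
- exact: commutingD.
- exact: commutingZ.
- exact: JX.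
Qed.

Ltac h_calc modesE :=
  let n0 := fresh "n0" in
  move=> n0; rewrite ?pairing_neg pairing_sym;
  let h1 := fresh in let h2 := fresh in
  have h1 := qnum_neq0 n0; have h2 := qnumD_neq0 n0;
  rewrite (pairing_vertex _ _ h1 (modesE n0)) /h_coef ?abszN ?absz_nat;
  match goal with i : node |- _ => case: i end => /=;
  match type of h1 with is_true (qnum _ ?m != _) => match m with ?n%:R =>
    qnum_field lnq alpha n n0 h1 h2 end end.

Ltac weight_calc i :=
  rewrite /h0_weight /chg /bosons !big_cons !big_nil !zero_modeE;
  case: i; rewrite ?(expoD, expoN) /= /ratioA /ratio2 ?eqxx;
  rewrite ?(oppr0, mul0r, mulr0, qpow0);
  by field; rewrite ?alpha1_neq0.

Lemma phi4_h_pos i n : (0 < n)%N -> h_pos i (phi4_exp lnq alpha) n =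
  - delta2 i * q_ ((1 + 3 / 2 * alpha) * n%:R) * (qn ((alpha + 1) * n%:R) / n%:R).
Proof. h_calc (phi4_modes_neg qnum_neq0 qnumD_neq0 (n := n)). Qed.

Lemma phi4_h_neg i n : (0 < n)%N -> h_neg i (phi4_exp lnq alpha) n =
  - delta2 i * q_ (- (1 + 1 / 2 * alpha) * n%:R) * (qn ((alpha + 1) * n%:R) / n%:R).
Proof. h_calc (phi4_modes_pos qnum_neq0 qnumD_neq0 (n := n)). Qed.

Lemma phi4_weight i : h0_weight lnq alpha i (chg (phi4_exp lnq alpha)) =
  - (alpha + 1) * delta2 i.
Proof. by rewrite /phi4_exp; weight_calc i. Qed.

Lemma phis1_h_pos i n : (0 < n)%N -> h_pos i (phis1_exp lnq alpha) n =
  delta2 i * q_ (3 / 2 * alpha * n%:R) * (qn (alpha * n%:R) / n%:R).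
Proof. h_calc (phis1_modes_neg qnum_neq0 qnumD_neq0 (n := n)). Qed.

Lemma phis1_h_neg i n : (0 < n)%N -> h_neg i (phis1_exp lnq alpha) n =
  delta2 i * q_ (- (1 / 2 * alpha) * n%:R) * (qn (alpha * n%:R) / n%:R).
Proof. h_calc (phis1_modes_pos qnum_neq0 qnumD_neq0 (n := n)). Qed.

Lemma phis1_weight i : h0_weight lnq alpha i (chg (phis1_exp lnq alpha)) =
  alpha * delta2 i.
Proof. by rewrite /phis1_exp; weight_calc i. Qed.

(** For i = 1 the b^13 and b^23 parts cancel. For i = 2 the a^2 part would give [(alpha+1) n]; the
    b^13 part adds q^(-(alpha/2+1)n) [n]/n, which lowers it to [alpha n]. *)
Lemma psi1_h_pos i n : (0 < n)%N -> h_pos i (psi1_exp lnq alpha) n =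
  - delta2 i * q_ (1 / 2 * alpha * n%:R) * (qn (alpha * n%:R) / n%:R).
Proof. h_calc (psi1_modes_neg qnum_neq0 qnumD_neq0 (n := n)). Qed.

Lemma psi1_h_neg i n : (0 < n)%N -> h_neg i (psi1_exp lnq alpha) n =
  - delta2 i * q_ (- (3 / 2 * alpha) * n%:R) * (qn (alpha * n%:R) / n%:R).
Proof. h_calc (psi1_modes_pos qnum_neq0 qnumD_neq0 (n := n)). Qed.

Lemma psi1_weight i : h0_weight lnq alpha i (chg (psi1_exp lnq alpha)) =
  - alpha * delta2 i.
Proof. by rewrite /psi1_exp; weight_calc i. Qed.

(** Opposite effect for i = 2: the factor [alpha n]/[(alpha+1) n] in the exponent leaves [alpha n]
    from a^2, and the b^13 part raises it to [(alpha+1) n]. *)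
Lemma psis4_h_pos i n : (0 < n)%N -> h_pos i (psis4_exp lnq alpha) n =
  delta2 i * q_ ((1 / 2 * alpha - 1) * n%:R) * (qn ((alpha + 1) * n%:R) / n%:R).
Proof. h_calc (psis4_modes_neg qnum_neq0 qnumD_neq0 (n := n)). Qed.

Lemma psis4_h_neg i n : (0 < n)%N -> h_neg i (psis4_exp lnq alpha) n =
  delta2 i * q_ ((- (3 / 2 * alpha) + 1) * n%:R) * (qn ((alpha + 1) * n%:R) / n%:R).
Proof. h_calc (psis4_modes_pos qnum_neq0 qnumD_neq0 (n := n)). Qed.

Lemma psis4_weight i : h0_weight lnq alpha i (chg (psis4_exp lnq alpha)) =
  (alpha + 1) * delta2 i.
Proof. by rewrite /psis4_exp; weight_calc i. Qed.

End Relations.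

Theorem theorem2 (R : realType) (lnq alpha : R[i])
    (F : lmodType R[i]) (x : boson -> int -> {linear F -> F}) (vac : F)
    (halpha0 : alpha != 0) (halpha1 : alpha != - 1)
    (hq : forall n : nat, (0 < n)%N -> qnum lnq n%:R != 0)
    (hqalpha : forall n : nat, (0 < n)%N ->
       qnum lnq ((alpha + 1) * n%:R) != 0)
    (hF : fock_module lnq alpha x vac) :
  let q_ := qpow lnq in
  let qn := qnum lnq in
  let delta2 := fun i : node => (is2 i)%:R : R[i] in
  let h := h_mode lnq alpha x in
  let qh := qh0 lnq alpha in
  let Xp := Xplus lnq alpha x in
  let Xm := Xminus lnq alpha x in
  let e := e_gen lnq alpha x in
  let f := f_gen lnq alpha x in
  let sqA := sqrtC (qn alpha) in
  let sqB := sqrtC (qn (alpha + 1)) in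
  let phi_4 := phi4 lnq alpha x in
  let phi_3 := phi3 lnq alpha x in
  let phi_2 := phi2 lnq alpha x in
  let phi_1 := phi1 lnq alpha x in
  let phis_1 := phis1 lnq alpha x in
  let phis_2 := phis2 lnq alpha x in
  let phis_3 := phis3 lnq alpha x in
  let phis_4 := phis4 lnq alpha x in
  let psi_1 := psi1 lnq alpha x in
  let psi_2 := psi2 lnq alpha x in
  let psi_3 := psi3 lnq alpha x in
  let psi_4 := psi4 lnq alpha x in
  let psis_4 := psis4 lnq alpha x in
  let psis_3 := psis3 lnq alpha x in
  let psis_2 := psis2 lnq alpha x in
  let psis_1 := psis1 lnq alpha x in
  (* the relations characterizing Phi_4 *)
  (forall i : node,
    [/\ forall s t : R[i],
          bracket false (is2 i) 1 (phi_4 s) (Xp i t) = 0,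
        forall s : R[i],
          qh F i 1 \o phi_4 s \o qh F i (- 1)
          = q_ (- (alpha + 1) * delta2 i) *: phi_4 s,
        forall (n : nat) (s : R[i]), (0 < n)%N ->
          bracket false false 1 (h i n%:Z) (phi_4 s)
          = (- delta2 i * q_ ((1 + 3 / 2 * alpha) * n%:R)
             * (qn ((alpha + 1) * n%:R) / n%:R)) *: zmul n%:R phi_4 s
      & forall (n : nat) (s : R[i]), (0 < n)%N ->
          bracket false false 1 (h i (- n%:Z)) (phi_4 s)
          = (- delta2 i * q_ (- (1 + 1 / 2 * alpha) * n%:R)
             * (qn ((alpha + 1) * n%:R) / n%:R)) *: zmul (- n%:R) phi_4 s]) /\
  (* the relations characterizing Phi^*_1 *)
  (forall i : node,
    [/\ forall s t : R[i],
          bracket false (is2 i) 1 (phis_1 s) (Xp i t) = 0,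
        forall s : R[i],
          qh F i 1 \o phis_1 s \o qh F i (- 1)
          = q_ (alpha * delta2 i) *: phis_1 s,
        forall (n : nat) (s : R[i]), (0 < n)%N ->
          bracket false false 1 (h i n%:Z) (phis_1 s)
          = (delta2 i * q_ (3 / 2 * alpha * n%:R)
             * (qn (alpha * n%:R) / n%:R)) *: zmul n%:R phis_1 s
      & forall (n : nat) (s : R[i]), (0 < n)%N ->
          bracket false false 1 (h i (- n%:Z)) (phis_1 s)
          = (delta2 i * q_ (- (1 / 2 * alpha) * n%:R)
             * (qn (alpha * n%:R) / n%:R)) *: zmul (- n%:R) phis_1 s]) /\
  (* the relations characterizing Psi_1 *)
  (forall i : node,
    [/\ forall s t : R[i],
          bracket false (is2 i) 1 (psi_1 s) (Xm i t) = 0,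
        forall s : R[i],
          qh F i 1 \o psi_1 s \o qh F i (- 1)
          = q_ (- alpha * delta2 i) *: psi_1 s,
        forall (n : nat) (s : R[i]), (0 < n)%N ->
          bracket false false 1 (h i n%:Z) (psi_1 s)
          = (- delta2 i * q_ (1 / 2 * alpha * n%:R)
             * (qn (alpha * n%:R) / n%:R)) *: zmul n%:R psi_1 s
      & forall (n : nat) (s : R[i]), (0 < n)%N ->
          bracket false false 1 (h i (- n%:Z)) (psi_1 s)
          = (- delta2 i * q_ (- (3 / 2 * alpha) * n%:R)
             * (qn (alpha * n%:R) / n%:R)) *: zmul (- n%:R) psi_1 s]) /\
  (* the relations characterizing Psi^*_4 *)
  (forall i : node,
    [/\ forall s t : R[i],
          bracket false (is2 i) 1 (psis_4 s) (Xm i t) = 0,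
        forall s : R[i],
          qh F i 1 \o psis_4 s \o qh F i (- 1)
          = q_ ((alpha + 1) * delta2 i) *: psis_4 s,
        forall (n : nat) (s : R[i]), (0 < n)%N ->
          bracket false false 1 (h i n%:Z) (psis_4 s)
          = (delta2 i * q_ ((1 / 2 * alpha - 1) * n%:R)
             * (qn ((alpha + 1) * n%:R) / n%:R)) *: zmul n%:R psis_4 s
      & forall (n : nat) (s : R[i]), (0 < n)%N ->
          bracket false false 1 (h i (- n%:Z)) (psis_4 s)
          = (delta2 i * q_ ((- (3 / 2 * alpha) + 1) * n%:R)
             * (qn ((alpha + 1) * n%:R) / n%:R)) *: zmul (- n%:R) psis_4 s]) /\
  (* e_i and f_i are the contour integrals of the currents *)
  (forall i : node, e i = oint (Xp i) /\ f i = oint (Xm i)) /\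
  (* the contour integrals satisfy the recursions *)
  (forall s : R[i],
    [/\ phi_3 s = - sqB^-1 *:
          bracket false true (q_ (- alpha - 1)) (phi_4 s) (f N2),
        phi_2 s = bracket true false (q_ 1) (phi_3 s) (f N1)
      & phi_1 s = - sqA^-1 *:
          bracket true true (q_ (- alpha)) (phi_2 s) (f N2)]) /\
  (forall s : R[i],
    [/\ psi_2 s = sqA^-1 *:
          bracket false true (q_ alpha) (psi_1 s) (e N2),
        psi_3 s = bracket true false (q_ 1) (psi_2 s) (e N1)
      & psi_4 s = sqB^-1 *:
          bracket true true (q_ (alpha + 1)) (psi_3 s) (e N2)]) /\
  (forall s : R[i],
    [/\ phis_2 s = (q_ (- alpha) / sqA) *:
          bracket false true (q_ alpha) (phis_1 s) (f N2),
        phis_3 s = - q_ (- 1) *: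
          bracket true false (q_ 1) (phis_2 s) (f N1)
      & phis_4 s = - (q_ (- alpha - 1) / sqB) *:
          bracket true true (q_ (alpha + 1)) (phis_3 s) (f N2)]) /\
  (forall s : R[i],
    [/\ psis_3 s = - (q_ (alpha + 1) / sqB) *:
          bracket false true (q_ (- alpha - 1)) (psis_4 s) (e N2),
        psis_2 s = - q_ 1 *:
          bracket true false (q_ 1) (psis_3 s) (e N1)
      & psis_1 s = (q_ alpha / sqA) *:
          bracket true true (q_ (- alpha)) (psis_2 s) (e N2)]).
Proof.
move=> q_ qn delta2 h qh Xp Xm e f sqA sqB phi_4 phi_3 phi_2 phi_1
  phis_1 phis_2 phis_3 phis_4 psi_1 psi_2 psi_3 psi_4 psis_4 psis_3 psis_2 psis_1.
have a1 : alpha + 1 != 0 by rewrite addr_eq0.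
have XpL i t : linear (Xp i t) := Xplus_linear hF i t.
have XmL i t : linear (Xm i t) := Xminus_linear hF i t.
have eE i : e i = Xp i (- 1) := e_genE lnq alpha x i.
have fE i : f i = Xm i (- 1) := f_genE lnq alpha x i.
have phi4E : phi_4 = fcomp (nexp alpha x (phi4_exp lnq alpha)) (phase alpha 0 [::]).
  by rewrite vexp_nil.
have phis1E : phis_1 = fcomp (nexp alpha x (phis1_exp lnq alpha)) (phase alpha 0 [::]).
  by rewrite vexp_nil.
have psi1E : psi_1 =
  fcomp (nexp alpha x (psi1_exp lnq alpha)) (phase alpha 1 [:: b13; b23]) by [].
have psis4E : psis_4 =
  fcomp (nexp alpha x (psis4_exp lnq alpha)) (phase alpha 1 [:: b13; b23]) by [].
split; [|split; [|split; [|split; [|split; [|split; [|split; [|split]]]]]]].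
- move=> i; rewrite phi4E; split.
  + apply: (bracket_Xplus hF) => K eps l s t g Kin.
    by apply: phi4_commute Kin => //; exact: hF.
  + move=> s; apply: (qh0_vexp hF); exact: phi4_weight.
  + by move=> n s n0; apply: (bracket_h_pos hF) => //; exact: phi4_h_pos.
  + by move=> n s n0; apply: (bracket_h_neg hF) => //; exact: phi4_h_neg.
- move=> i; rewrite phis1E; split.
  + apply: (bracket_Xplus hF) => K eps l s t g Kin.
    by apply: phis1_commute Kin => //; exact: hF.
  + move=> s; apply: (qh0_vexp hF); exact: phis1_weight.
  + by move=> n s n0; apply: (bracket_h_pos hF) => //; exact: phis1_h_pos.
  + by move=> n s n0; apply: (bracket_h_neg hF) => //; exact: phis1_h_neg.
- move=> i; rewrite psi1E; split.
  + apply: (bracket_Xminus hF) => K eps l s t g Kin.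
    by apply: psi1_commute Kin => //; exact: hF.
  + move=> s; apply: (qh0_vexp hF); exact: psi1_weight.
  + by move=> n s n0; apply: (bracket_h_pos hF) => //; exact: psi1_h_pos.
  + by move=> n s n0; apply: (bracket_h_neg hF) => //; exact: psi1_h_neg.
- move=> i; rewrite psis4E; split.
  + apply: (bracket_Xminus hF) => K eps l s t g Kin.
    by apply: psis4_commute Kin => //; exact: hF.
  + move=> s; apply: (qh0_vexp hF); exact: psis4_weight.
  + by move=> n s n0; apply: (bracket_h_pos hF) => //; exact: psis4_h_pos.
  + by move=> n s n0; apply: (bracket_h_neg hF) => //; exact: psis4_h_neg.
- by move=> i; rewrite eE fE.
(* As [oint] and the zero mode both pick the exponent -1, the nested integrals already are nested
   brackets; what remains is to collect the constants of successive steps. *)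
- move=> s; rewrite !fE; split => //.
    by rewrite /phi_3 /phi3 (bracketZl _ _ _ _ _ (XmL N1 (- 1))).
  by rewrite /phi_2 /phi2 (bracketZl _ _ _ _ _ (XmL N2 (- 1)))
    scalerA mulrNN -invfM.
- move=> s; rewrite !eE; split => //.
    by rewrite /psi_2 /psi2 (bracketZl _ _ _ _ _ (XpL N1 (- 1))).
  by rewrite /psi_3 /psi3 (bracketZl _ _ _ _ _ (XpL N2 (- 1)))
    scalerA -invfM [sqB * _]mulrC.
- move=> s; rewrite !fE; split => //.
    rewrite /phis_2 /phis2 (bracketZl _ _ _ _ _ (XmL N1 (- 1)))
      scalerA mulNr mulrA -qpowD.
    by rewrite [- 1 + _]addrC.
  rewrite /phis_3 /phis3 (bracketZl _ _ _ _ _ (XmL N2 (- 1))) scalerA mulrNN.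
  have -> : q_ (- alpha - 1) / sqB * (q_ (- alpha - 1) / sqA) =
      q_ (- 2 * alpha - 2) / (sqA * sqB).
    rewrite invfM mulrACA -qpowD [sqB^-1 * _]mulrC.
    by congr (q_ _ * _); ring.
  reflexivity.
- move=> s; rewrite !eE; split => //.
    rewrite /psis_3 /psis3 (bracketZl _ _ _ _ _ (XpL N1 (- 1)))
      scalerA mulrNN mulrA -qpowD.
    by have -> : 1 + (alpha + 1) = alpha + 2 by ring.
  rewrite /psis_2 /psis2 (bracketZl _ _ _ _ _ (XpL N2 (- 1))) scalerA.
  have -> : q_ alpha / sqA * (q_ (alpha + 2) / sqB) = q_ (2 * alpha + 2) / (sqA * sqB).
    rewrite invfM mulrACA -qpowD.
    by congr (q_ _ * _); ring.
  reflexivity.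
Qed.
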